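(* Let $\{Q_{\pm}^{i}(z)\}_{i=1}^{r}$ be an isolated solution of the infinite $QQ$-system associated to $G$ and monic polynomials $\Lambda_1(z),\ldots,\Lambda_r(z)\in\mathbb{C}[z]$. Then there exist $\epsilon>0$ and polynomials $\{Q_{\pm}^{i,Z}(z)\}_{i=1}^{r}$ that lift $\{Q_{\pm}^{i}(z)\}_{i=1}^{r}$ and solve the $QQ$-system $$\tilde{\xi}_{i}\,Q_{+}^{i,Z}(qz)Q_{-}^{i,Z}(z)-\xi_{i}\, Q_{+}^{i,Z}(z)Q_{-}^{i,Z}(qz)=\Lambda_{i}(z)\prod_{j\neq i}\big[Q_{+}^{j,Z}(z)\big]^{-a_{ji}},\qquad i=1,\ldots,r,$$ for all $Z\in H$ satisfying $|t_{i}|<\epsilon$ for all $i$.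
   Context: $G$ is a connected, simply connected, simple algebraic group of rank $r$ over $\mathbb{C}$ with maximal torus $H$, simple roots $\alpha_1,\ldots,\alpha_r$, simple coroots $\check\alpha_1,\ldots,\check\alpha_r$, and Cartan matrix $a_{ij}=\langle\alpha_j,\check\alpha_i\rangle$; $q\in\mathbb{C}^\times$ is fixed. An element $Z\in H$ is written uniquely as $Z=\prod_i\check\alpha_i(\zeta_i)$ with $\zeta_i\in\mathbb{C}^\times$, and it is assumed throughout that $\prod_i\zeta_i^{a_{ij}}\notin q^{\mathbb{Z}}$ for $1\le j\le r$. Put $$\tilde\xi_i=\zeta_i\prod_{j>i}\zeta_j^{a_{ji}},\qquad \xi_i=\zeta_i^{-1}\prod_{j<i}\zeta_j^{-a_{ji}},\qquad \hat\xi_i=\prod_j\zeta_j^{a_{ji}},\qquad t_i=\hat\xi_i^{-1}.$$ In the $QQ$-system the $Q_+^i$ are assumed monic. The infinite $QQ$-system associated to $G$ and $\Lambda_1,\ldots,\Lambda_r$ is $$Q_{+}^{i}(qz)Q_{-}^{i}(z)=\Lambda_{i}(z)\prod_{j\neq i}\big[Q_{+}^{j}(z)\big]^{-a_{ji}},\qquad i=1,\ldots,r,$$ for polynomials $Q_\pm^i(z)$ with the $Q_+^i$ monic. It is obtained from the $QQ$-system by setting $\tilde Q_-^i=\tilde\xi_iQ_-^i$ and letting $\hat\xi_i\to\infty$ for each $i$. A solution is isolated if it is an isolated point of the set of solutions having the same degrees (identified with tuples of coefficients). The polynomials $Q_\pm^{i,Z}$ lift $Q_\pm^i$ if they have the same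 degrees as $Q_\pm^i$ and the coefficients of $Q_+^{i,Z}(z)$ and of $\tilde\xi_iQ_-^{i,Z}(z)$ tend to those of $Q_+^i(z)$ and $Q_-^i(z)$ as $(t_1,\ldots,t_r)\to(0,\ldots,0)$. *)

(* Defs.v *)
From HB Require Import structures.
From mathcomp Require Import all_boot all_order all_algebra.
From mathcomp Require Import all_classical all_reals all_analysis.
From mathcomp Require Import complex.
Set Implicit Arguments.
Unset Strict Implicit.
Unset Printing Implicit Defensive.
Import Order.TTheory GRing.Theory Num.Theory.
Import numFieldNormedType.Exports.
Local Open Scope classical_set_scope.
Local Open Scope ring_scope.
Local Open Scope complex_scope.

(* A reductive group G with maximal torus H and a choice of simple roots is
   given by its based root datum.  Bases of the character lattice X and of the
   cocharacter lattice Y of H are chosen to be dual to each other, so that both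
   lattices become 'rV[int]_r and the pairing X x Y -> Z is the standard one. *)
Definition pairing (r : nat) (x y : 'rV[int]_r) : int := (x *m y^T) 0 0.

Record based_root_datum (r : nat) := BasedRootDatum {
  roots : seq 'rV[int]_r;
  coroot : 'rV[int]_r -> 'rV[int]_r;
  simple_root : 'I_r -> 'rV[int]_r;
  (* (X, roots, Y, coroot @` roots) is a reduced root datum *)
  coroot_inj : {in roots &, injective coroot};
  pairing_coroot : {in roots, forall al, pairing al (coroot al) = 2};
  reflection_roots : {in roots &, forall al be,
    be - pairing be (coroot al) *: al \in roots};
  reflection_coroots : {in roots &, forall al be,
    coroot be - pairing al (coroot be) *: coroot al \in map coroot roots};
  roots_reduced : {in roots, forall al, al *+ 2 \notin roots};
  (* the simple roots are a base; they are as many as the rank of X, so that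
     G is semisimple *)
  simple_root_in : forall i, simple_root i \in roots;
  simple_root_indep : \det (\matrix_(i < r) simple_root i) != 0;
  simple_root_span : {in roots, forall al, exists c : 'I_r -> nat,
    al = \sum_(i < r) simple_root i *+ c i \/
    al = - \sum_(i < r) simple_root i *+ c i}
}.

(* G is simple: its root system is nonempty and irreducible. *)
Definition simple_datum (r : nat) (D : based_root_datum r) : Prop :=
  roots D != [::] /\
  forall P : pred 'rV[int]_r,
    has P (roots D) ->
    {in roots D &, forall al be,
       P al -> ~~ P be -> pairing be (coroot D al) = 0} ->
    all P (roots D).

(* G is simply connected: the simple coroots form a Z-basis of Y.  Hence
   (zeta_i)_i |-> \prod_i coroot_i(zeta_i) is an isomorphism from (C^* )^r onto
   H, through which elements of H are given below by their coordinates. *)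
Definition simply_connected_datum (r : nat) (D : based_root_datum r) : Prop :=
  (\matrix_(i < r) coroot D (simple_root D i) : 'M[int]_r) \in unitmx.

(* a_ij = < alpha_j , coroot_i > *)
Definition cartan_matrix (r : nat) (D : based_root_datum r) : 'M[int]_r :=
  \matrix_(i, j) pairing (simple_root D j) (coroot D (simple_root D i)).

Section QQ.
Variables (R : realType) (r : nat) (a : 'M[int]_r).
Implicit Types (zeta : 'I_r -> R[i]) (q : R[i]).
Implicit Types (L Qp Qm Pp Pm : 'I_r -> {poly R[i]}).

Definition tilde_xi zeta (i : 'I_r) : R[i] :=
  zeta i * \prod_(j < r | (i < j)%N) zeta j ^ a j i.

Definition xi zeta (i : 'I_r) : R[i] :=
  (zeta i)^-1 * \prod_(j < r | (j < i)%N) zeta j ^ (- a j i).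

Definition hat_xi zeta (i : 'I_r) : R[i] := \prod_(j < r) zeta j ^ a j i.

Definition t_coord zeta (i : 'I_r) : R[i] := (hat_xi zeta i)^-1.

(* The elements Z of H satisfying the standing genericity assumption. *)
Definition generic_torus q zeta : Prop :=
  (forall i, zeta i != 0) /\ (forall (j : 'I_r) (m : int), hat_xi zeta j != q ^ m).

Definition qshift q (p : {poly R[i]}) : {poly R[i]} := p \Po (q *: 'X).

(* The exponents - a_ji are nonnegative, as j != i. *)
Definition QQ_rhs L Qp (i : 'I_r) : {poly R[i]} :=
  L i * \prod_(j < r | j != i) Qp j ^ (- a j i).

Definition QQ_system q L zeta Qp Qm : Prop :=
  (forall i, Qp i \is monic) /\
  (forall i, tilde_xi zeta i *: (qshift q (Qp i) * Qm i)
             - xi zeta i *: (Qp i * qshift q (Qm i)) = QQ_rhs L Qp i).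

Definition infinite_QQ_system q L Qp Qm : Prop :=
  (forall i, Qp i \is monic) /\
  (forall i, qshift q (Qp i) * Qm i = QQ_rhs L Qp i).

Definition same_degrees Pp Pm Qp Qm : Prop :=
  forall i, size (Pp i) = size (Qp i) /\ size (Pm i) = size (Qm i).

(* R[i]^o is R[i] with the topology of its norm. *)
Definition coefs (n : nat) Qp Qm : 'M[R[i]^o]_(r, n) * 'M[R[i]^o]_(r, n) :=
  (\matrix_(i < r, k < n) (Qp i)`_k, \matrix_(i < r, k < n) (Qm i)`_k).

Definition isolated_infinite_solution q L Qp Qm : Prop :=
  let n := (\max_(i < r) maxn (size (Qp i)) (size (Qm i)))%N in
  infinite_QQ_system q L Qp Qm /\
  isolated
    [set c | exists Pp Pm, infinite_QQ_system q L Pp Pm /\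
               same_degrees Pp Pm Qp Qm /\ c = coefs n Pp Pm]
    (coefs n Qp Qm).

Definition t_ball q (e : R) : set ('I_r -> R[i]) :=
  [set zeta | generic_torus q zeta /\ forall i, `|t_coord zeta i| < e%:C].

(* The filter (t_1, ..., t_r) --> (0, ..., 0) on generic elements of H. *)
Definition t_to_0 q : set_system ('I_r -> R[i]) :=
  filter_from [set e : R | 0 < e] (t_ball q).

(* The families QpZ, QmZ lift Qp, Qm; they matter only for Z in t_ball q e. *)
Definition lifts q (e : R) (QpZ QmZ : ('I_r -> R[i]) -> 'I_r -> {poly R[i]})
    Qp Qm : Prop :=
  (forall zeta, t_ball q e zeta -> same_degrees (QpZ zeta) (QmZ zeta) Qp Qm) /\
  (forall (i : 'I_r) (k : nat),
    ((fun zeta => (QpZ zeta i)`_k : R[i]^o) @ t_to_0 q --> ((Qp i)`_k : R[i]^o)) /\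
    ((fun zeta => (tilde_xi zeta i *: QmZ zeta i)`_k : R[i]^o) @ t_to_0 q
       --> ((Qm i)`_k : R[i]^o))).

End QQ.

(* Main.v *)
Require Import Defs.
From HB Require Import structures.
From mathcomp Require Import all_boot all_order all_algebra.
From mathcomp Require Import complex.
From mathcomp Require Import boolp classical_sets reals.
From mathcomp Require mpoly.
From mathcomp Require Import ring lra.
Set Implicit Arguments.
Unset Strict Implicit.
Unset Printing Implicit Defensive.
Import Order.TTheory GRing.Theory Num.Theory.
Local Open Scope ring_scope.

(** Put Q~_i = tilde_xi_i Q_-^i.  Then the QQ-system reads
      Q_+^i(qz) Q~_i(z) - t_i Q_+^i(z) Q~_i(qz)
        = Lambda_i(z) \prod_(j != i) Q_+^j(z)^(- a_ji),
    because xi_i = t_i tilde_xi_i (lemma xiE).  It is a perturbation, small with t, of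
    the infinite system, and in fixed degrees it has as many unknowns as equations.
    So the theorem is an instance of the principle that an isolated zero of a square
    polynomial system survives small perturbations.  The zero may be multiple, so
    the implicit function theorem does not apply.

    The unknowns used here are not coefficients but roots, centered at the given
    solution: x_v displaces one root of Q_+^i(qz) or of Q_-^i.  The equations of the
    infinite system then say that two multisets of affine functionals of x coincide for
    each i: the roots of Q_+^i(qz) Q_-^i(z) on one side, those of Lambda_i and, for
    j != i, q times those of Q_+^j(qz), each repeated - a_ji times, on the other.  The zero set is a finite union of affine
    subspaces, one for each way of matching the two multisets, and an isolated solution
    lies on none of positive dimension (no_solution_line).  Evaluating the i-th
    difference of products at one of the roots shows that a product of differences of
    roots lies in the ideal of the system; splitting off its factors one at a time
    follows all the matchings, and shows that the ideal contains U m^k, where m is the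
    maximal ideal of the origin and U is nonzero there (root_eqs_isolated).  This gives
    identities U x_j^(k+1) = \sum_l h_jl F_l between the equations F_l = 0.

    From these identities persistence is proved by a dual argument (zeros_persist).
    Let F' be near F and G_j = \sum_l h_jl F'_l, a small deformation of x_j^(k+1) on a
    small polydisc.  The functionals on polynomials that are bounded on the polydisc and
    vanish on the ideal of the G_j form a finite-dimensional deformation of the dual of
    C[x]/(x_j^(k+1)); by a contraction argument it contains a functional c close to the
    coefficient of the top monomial x^top = \prod_j x_j^k (step_fixpoint,
    step_fix_killed).  By Cramer's rule the functional f |-> c(f det h) vanishes on the
    ideal of the F'_l.  It is not zero: writing F = A x, one has
    det h det A = x^top modulo the x_j^(k+1), up to a factor equal to 1 at the origin
    (socle_coeff).  Hence the bounded functionals that vanish on the ideal of the F'_l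
    form a nonzero finite-dimensional space, on which multiplications by the x_j have a
    common eigenvector; this is a multiple of the evaluation at a point of the polydisc,
    a zero of F' (solution_zero). *)

(** * Geometric limits of complex sequences *)

Section ComplexLimits.
Variable R : realType.
Local Notation C := R[i].

Lemma real_geometric_limit (x : nat -> R) (B : R) :
  (forall m, `|x m.+1 - x m| <= B / 2 ^+ m) ->
  exists l, forall m, `|l - x m| <= (B *+ 2) / 2 ^+ m.
Proof.
move=> hx; pose b m := (B *+ 2) / 2 ^+ m.
have bS m : b m.+1 = b m - B / 2 ^+ m.
  rewrite /b exprS; have : (2 : R) ^+ m != 0 by rewrite expf_neq0 // pnatr_eq0.
  by move=> h; field.
have up m : x m - b m <= x m.+1 - b m.+1.
  by have := hx m; rewrite ler_norml bS => /andP[h1 h2]; lra.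
have dn m : x m.+1 + b m.+1 <= x m + b m.
  by have := hx m; rewrite ler_norml bS => /andP[h1 h2]; lra.
have b0 m : 0 <= b m.
  have B0 : 0 <= B by have := le_trans (normr_ge0 _) (hx 0%N); rewrite expr0 divr1.
  by rewrite /b divr_ge0 ?mulrn_wge0 ?exprn_ge0.
have mono m k : x m - b m <= x (k + m)%N - b (k + m)%N.
  by elim: k => // k; move/le_trans; apply; rewrite addSn.
have mono' m k : x (k + m)%N + b (k + m)%N <= x m + b m.
  by elim: k => // k; apply: le_trans; rewrite addSn.
pose E : set R := [set y | exists m, y = x m - b m]%classic.
have ubE m : ubound E (x m + b m).
  move=> _ [k ->]; have h1 := mono k m; have h2 := mono' m k.
  by rewrite addnC in h2; have := b0 (m + k)%N; lra.
have supE : has_sup E.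
  by split; [exists (x 0%N - b 0%N); exists 0%N | exists (x 0%N + b 0%N); exact: ubE].
exists (sup E) => m; rewrite ler_norml -/(b m).
have h1 : x m - b m <= sup E by apply: ub_le_sup; [case: supE|exists m].
have h2 : sup E <= x m + b m by apply: ge_sup; [case: supE|exact: ubE].
by apply/andP; split; lra.
Qed.

Lemma norm_Re (z : C) : (complex.Re `|z|)%:C%C = `|z|.
Proof. by rewrite RRe_real // normr_real. Qed.

Lemma Re_norm (z : C) : `|complex.Re z| <= complex.Re `|z|.
Proof. by rewrite -lecR norm_Re normc_ge_Re. Qed.

Lemma complex_geometric_limit (z : nat -> C) (B : C) :
  (forall m, `|z m.+1 - z m| <= B / 2 ^+ m) ->
  exists l, forall m, `|l - z m| <= (B *+ 4) / 2 ^+ m.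
Proof.
move=> hz.
have B0 : 0 <= B by have := le_trans (normr_ge0 _) (hz 0%N); rewrite expr0 divr1.
have [b eB] : exists b : R, B = b%:C%C.
  by exists (complex.Re B); rewrite RRe_real // ger0_real.
have hb m : (b%:C / 2 ^+ m)%C = (b / 2 ^+ m)%:C%C.
  by rewrite rmorphM fmorphV rmorphXn rmorph_nat.
have hz' m : complex.Re `|z m.+1 - z m| <= b / 2 ^+ m.
  by rewrite -lecR norm_Re -hb -eB.
have [m|l1 h1] := @real_geometric_limit (fun m => complex.Re (z m)) b.
  by rewrite -raddfB; apply: le_trans (Re_norm _) (hz' m).
have [m|l2 h2] := @real_geometric_limit (fun m => complex.Im (z m)) b.
  apply: le_trans (hz' m); rewrite -raddfB /=.
  have := Re_norm ('i%C * (z m.+1 - z m)).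
  by rewrite mulrC ReiNIm normrN normrM -[X in _ * X]/`|'i%C| [`|'i%C|](_ : _ = 1) ?mulr1 //
     complexiE normCi.
exists (Complex l1 l2) => m.
have -> : Complex l1 l2 - z m =
    (l1 - complex.Re (z m))%:C%C + 'i%C * (l2 - complex.Im (z m))%:C%C.
  rewrite [LHS]complexE !raddfB /=; case: (z m) => u v /=.
  by rewrite -!raddfB.
apply: le_trans (ler_normD _ _) _.
have nr (u : R) : `|u%:C%C| = `|u|%:C%C.
  by rewrite normc_def /= expr0n addr0 sqrtr_sqr.
rewrite normrM complexiE normCi mul1r !nr eB -raddfMn /= -[_ / _]/(_ * _).
rewrite -rmorphD /= (_ : (b *+ 4)%:C%C / 2 ^+ m = ((b *+ 4) / 2 ^+ m)%:C%C); last first.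
  by rewrite rmorphM fmorphV rmorphXn rmorph_nat.
rewrite lecR; have := h1 m; have := h2 m.
rewrite !mulrnAl (_ : 4 = 2 + 2)%N // mulrnDr => a1 a2.
by apply: le_trans (lerD a2 a1) _.
Qed.

Lemma le_geometric_eq0 (z B : C) : (forall m, `|z| <= B / 2 ^+ m) -> z = 0.
Proof.
move=> hz.
have B0 : 0 <= B by have := le_trans (normr_ge0 _) (hz 0%N); rewrite expr0 divr1.
have [b eB] : exists b : R, B = b%:C%C.
  by exists (complex.Re B); rewrite RRe_real // ger0_real.
apply/eqP; rewrite -normr_eq0 -norm_Re; apply/eqP; congr (_ %:C)%C.
set a := complex.Re _.
have a0 : 0 <= a by rewrite -lecR norm_Re normr_ge0.
have ha m : a <= b / 2 ^+ m.
  rewrite -lecR norm_Re (_ : (b / 2 ^+ m)%:C%C = B / 2 ^+ m) //.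
  by rewrite eB rmorphM fmorphV rmorphXn rmorph_nat.
apply/eqP; rewrite eq_le a0 andbT leNgt; apply/negP => agt0.
have b0 : 0 <= b by rewrite -ler0c -eB.
have hm := truncnS_gt (b / a); move: (Num.truncn _).+1 hm => m hm.
have hm2 : m%:R <= 2 ^+ m :> R by rewrite -natrX ler_nat ltnW // ltn_expl.
have h : b / a < 2 ^+ m := lt_le_trans hm hm2.
have h2 : b / 2 ^+ m < a.
  by rewrite ltr_pdivrMr ?exprn_gt0 // mulrC -ltr_pdivrMr.
by have := lt_le_trans h2 (ha m); rewrite ltxx.
Qed.

End ComplexLimits.

(** * Polynomials acting on functionals *)

Section PolynomialAction.
Import mpoly.
Variables (R : realType) (n : nat).
Local Notation C := R[i].
Local Notation P := {mpoly C[n]}.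
Local Notation mon := 'X_{1..n}.
Implicit Types (f g : P) (c : mon -> C) (a b m : mon).

(** A sequence c stands for the linear functional on polynomials that sends the
    monomial x^a to c a.  Then act f c stands for g |-> c (f g). *)
Definition act f c a : C := \sum_(e <- msupp f) f@_e * c (a + e)%MM.

Lemma act_support (s : seq mon) f c a :
  uniq s -> {subset msupp f <= s} -> act f c a = \sum_(e <- s) f@_e * c (a + e)%MM.
Proof.
move=> us sub; rewrite (bigID (mem (msupp f))) /= [X in _ + X]big1 ?addr0; last first.
  by move=> e he; rewrite memN_msupp_eq0 // mul0r.
rewrite -big_filter; apply/perm_big/uniq_perm; rewrite ?filter_uniq ?msupp_uniq //.
by move=> e; rewrite mem_filter; apply/idP/andP => [h|[]//]; split=> //; apply: sub.
Qed.

Lemma actD f g c a : act (f + g) c a = act f c a + act g c a.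
Proof.
set s := undup (msupp f ++ msupp g ++ msupp (f + g)).
rewrite !(@act_support s) ?undup_uniq //;
  try by move=> e he; rewrite mem_undup !mem_cat he ?orbT.
by rewrite -big_split; apply: eq_bigr => e _; rewrite mcoeffD mulrDl.
Qed.

Lemma act0 c a : act 0 c a = 0.
Proof. by rewrite /act msupp0 big_nil. Qed.

Lemma actZ k f c a : act (k *: f) c a = k * act f c a.
Proof.
rewrite (@act_support (msupp f)) ?msupp_uniq //; last exact: msuppZ_le.
by rewrite mulr_sumr; apply: eq_bigr => e _; rewrite mcoeffZ mulrA.
Qed.

Lemma actN f c a : act (- f) c a = - act f c a.
Proof. by rewrite -scaleN1r actZ mulN1r. Qed.

Lemma actB f g c a : act (f - g) c a = act f c a - act g c a.
Proof. by rewrite actD actN. Qed.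

Lemma act_sum (I : Type) (r : seq I) (Q : pred I) (F : I -> P) c a :
  act (\sum_(i <- r | Q i) F i) c a = \sum_(i <- r | Q i) act (F i) c a.
Proof.
by elim/big_rec2: _ => [|i x y _ <-]; rewrite ?act0 // actD.
Qed.

Lemma actX m c a : act 'X_[m] c a = c (a + m)%MM.
Proof. by rewrite /act msuppX big_seq1 mcoeffX eqxx mul1r. Qed.

Lemma act1 c a : act 1 c a = c a.
Proof. by rewrite -mpolyX0 actX addm0. Qed.

Lemma actXM m g c a : act ('X_[m] * g) c a = act g c (a + m)%MM.
Proof.
rewrite {1}(mpolyE g) mulr_sumr act_sum {2}/act; apply: eq_bigr => e _.
by rewrite -scalerAr actZ -mpolyXD actX addmA.
Qed.

Lemma actM f g c : act (f * g) c = act f (act g c).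
Proof.
apply/funext => a; rewrite {1}(mpolyE f) mulr_suml act_sum {2}/act.
by apply: eq_bigr => e _; rewrite -scalerAl actZ actXM.
Qed.

Lemma act_commute f g c : act f (act g c) = act g (act f c).
Proof. by rewrite -!actM mulrC. Qed.

Lemma act_sub f c c' a : act f (fun a => c a - c' a) a = act f c a - act f c' a.
Proof. by rewrite /act -sumrB; apply: eq_bigr => e _; rewrite mulrBr. Qed.

Lemma act_zero f a : act f (fun=> 0) a = 0.
Proof. by apply: big1 => e _; rewrite mulr0. Qed.

(** The functional c extends to the power series that converge absolutely at
    (rho, ..., rho), with norm at most N. *)
Definition dominated (rho N : C) c := forall a, `|c a| <= N * rho ^+ mdeg a.

(** Multiplication by f has norm at most B on the functionals bounded at radius rho. *)
Definition op_bound (rho : C) f B :=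
  forall c N, dominated rho N c -> dominated rho (B * N) (act f c).

Lemma dominated_ge0 rho N c : dominated rho N c -> 0 <= N.
Proof. by move/(_ 0%MM); rewrite mdeg0 expr0 mulr1; apply: le_trans. Qed.

Lemma op_boundD rho f g B B' :
  op_bound rho f B -> op_bound rho g B' -> op_bound rho (f + g) (B + B').
Proof.
move=> hf hg c N hc a; rewrite actD !mulrDl; apply: le_trans (ler_normD _ _) _.
by rewrite lerD ?hf ?hg.
Qed.

Lemma op_boundM rho f g B B' :
  op_bound rho f B -> op_bound rho g B' -> op_bound rho (f * g) (B * B').
Proof. by move=> hf hg c N hc a; rewrite actM -(mulrA B); exact: (hf _ _ (hg _ _ hc)). Qed.

Lemma op_boundZ rho k f B : op_bound rho f B -> op_bound rho (k *: f) (`|k| * B).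
Proof.
by move=> hf c N hc a; rewrite actZ normrM -!mulrA ler_wpM2l // mulrA hf.
Qed.

Lemma op_bound0 rho : op_bound rho 0 0.
Proof. by move=> c N hc a; rewrite act0 normr0 !mul0r. Qed.

Lemma op_bound_sum (I : Type) (r : seq I) rho (F : I -> P) (B : I -> C) :
  (forall i, op_bound rho (F i) (B i)) ->
  op_bound rho (\sum_(i <- r) F i) (\sum_(i <- r) B i).
Proof.
move=> h; elim/big_rec2: _ => [|i x y _ hy]; first exact: op_bound0.
exact: op_boundD.
Qed.

Lemma op_bound_le rho f B B' : 0 <= rho -> B <= B' -> op_bound rho f B -> op_bound rho f B'.
Proof.
move=> r0 hB h c N hc a; apply: le_trans (h c N hc a) _.
by rewrite ler_wpM2r ?exprn_ge0 // ler_wpM2r // (dominated_ge0 hc).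
Qed.

Lemma op_boundX rho m : op_bound rho 'X_[m] (rho ^+ mdeg m).
Proof.
move=> c N hc a; rewrite actX; apply: le_trans (hc _) _.
by rewrite mdegD exprD [X in X <= _](_ : _ = rho ^+ mdeg m * N * rho ^+ mdeg a) //; ring.
Qed.

Lemma op_bound_unif f :
  exists2 B, 0 <= B & forall rho, 0 <= rho <= 1 -> op_bound rho f B.
Proof.
exists (\sum_(e <- msupp f) `|f@_e|); first by apply: sumr_ge0.
move=> rho /andP[r0 r1]; rewrite {1}(mpolyE f).
apply: op_bound_sum => e; apply: op_bound_le (op_boundZ _ (op_boundX _)) => //.
by rewrite ler_piMr // exprn_ile1.
Qed.

End PolynomialAction.

(** * Functionals killed by deformed powers of the variables *)

Section Deformation.
Import mpoly.
Variables (R : realType) (n k : nat).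
Local Notation C := R[i].
Local Notation P := {mpoly C[n]}.
Local Notation mon := 'X_{1..n}.
Variables (g : 'I_n -> P) (rho : C).
Hypothesis rho_gt0 : 0 < rho.
Hypothesis g_small : forall j, op_bound rho (g j) (rho ^+ k.+1 / 2).
Implicit Types (c : mon -> C) (a b : mon).

Definition xpow (j : 'I_n) : mon := (U_(j) *+ k.+1)%MM.
Definition deformed j : P := 'X_[xpow j] + g j.
Definition top_mon : mon := [multinom k | i < n].
Definition top_dual a : C := (a == top_mon)%:R.
Definition reduced a := forall j, (a j <= k)%N.

Definition first_big a : option 'I_n :=
  [pick j : 'I_n | (k < a j)%N && [forall i : 'I_n, (i < j)%N ==> (a i <= k)%N]].

Variant first_big_spec a : option 'I_n -> Type :=
  | FirstBig j of (k < a j)%N & (forall i : 'I_n, (i < j)%N -> (a i <= k)%N) :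
      first_big_spec a (Some j)
  | NoBig of reduced a : first_big_spec a None.

Lemma first_bigP a : first_big_spec a (first_big a).
Proof.
rewrite /first_big; case: pickP => [j /andP[h /forallP h']|h].
  by apply: FirstBig => // i; apply/implyP.
apply: NoBig => j; rewrite leqNgt; apply/negP => kj.
case: (@arg_minnP _ j (fun i : 'I_n => (k < a i)%N) (fun i => val i) kj) => i ki imin.
have := h i; rewrite ki /= => /forallP[] l; apply/implyP => li.
by rewrite leqNgt; apply/negP => /imin; rewrite leqNgt li.
Qed.

(** The values of a functional killed by all x_j^(k+1) + g_j obey a recurrence: on a
    monomial divisible by x_j^(k+1), replace this factor by - g_j.  When several j are
    possible the first is used; step_fix_killed shows that the others then give the same
    value.  On the remaining monomials the values are prescribed, as those of the
    coefficient of the top monomial. *)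
Definition step c a : C :=
  if first_big a is Some j then - act (g j) c (a - xpow j)%MM else top_dual a.

Lemma xpowE j i : xpow j i = ((j == i) * k.+1)%N.
Proof. by rewrite /xpow mulmnE mnm1E. Qed.

Lemma xpowK a j : (k < a j)%N -> (a - xpow j + xpow j)%MM = a.
Proof.
move=> h; apply: submK; apply/mnm_lepP => i; rewrite xpowE.
by case: eqP => [<-|_]; rewrite ?mul1n.
Qed.

Lemma mdeg_xpow a j : (k < a j)%N -> mdeg a = (k.+1 + mdeg (a - xpow j)%MM)%N.
Proof. by move=> h; rewrite -{1}(xpowK h) mdegD mdegMn mdeg1 mul1n addnC. Qed.

Lemma act_g_small c N a j : dominated rho N c -> (k < a j)%N ->
  `|act (g j) c (a - xpow j)%MM| <= N / 2 * rho ^+ mdeg a.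
Proof.
move=> hc ha; apply: le_trans (g_small j hc (a - xpow j)%MM) _.
rewrite (mdeg_xpow ha) exprD [X in X <= _](_ : _ = N / 2 *
  (rho ^+ k.+1 * rho ^+ mdeg (a - xpow j)%MM)) //; ring.
Qed.

Lemma dominated_half N c :
  (forall N', dominated rho N' c -> dominated rho (N' / 2) c) ->
  dominated rho N c -> forall a, c a = 0.
Proof.
move=> half hN a; apply: (@le_geometric_eq0 _ _ (N * rho ^+ mdeg a)) => m.
have : dominated rho (N / 2 ^+ m) c.
  elim: m => [|m IH]; first by rewrite expr0 divr1.
  by have := half _ IH; rewrite -mulrA -invfM exprSr.
by move/(_ a); rewrite mulrAC.
Qed.

(** Bounded functionals killed by the deformed powers are determined by their values on
    the finitely many reduced monomials, so they form a finite-dimensional space. *)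
Lemma deformed_unique c N : dominated rho N c ->
  (forall j a, act (deformed j) c a = 0) ->
  (forall a, reduced a -> c a = 0) -> forall a, c a = 0.
Proof.
move=> hN kill red; apply: (dominated_half _ hN) => N' hN' a.
have N0 := dominated_ge0 hN'.
case: (first_bigP a) => [j aj _|ra].
  have := kill j (a - xpow j)%MM; rewrite actD actX xpowK // => /eqP.
  by rewrite addr_eq0 => /eqP ->; rewrite normrN act_g_small.
by rewrite red // normr0 mulr_ge0 ?exprn_ge0 ?divr_ge0 // ltW.
Qed.

Lemma step_contract N c c' : dominated rho N (fun a => c a - c' a) ->
  dominated rho (N / 2) (fun a => step c a - step c' a).
Proof.
move=> hN a; have N0 := dominated_ge0 hN; rewrite /step.
case: first_bigP => [j aj _|ra].
  by rewrite -opprD normrN -act_sub act_g_small.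
by rewrite subrr normr0 mulr_ge0 ?exprn_ge0 ?divr_ge0 // ltW.
Qed.

Lemma step_fixpoint N : dominated rho N (fun a => step top_dual a - top_dual a) ->
  exists2 c, forall a, step c a = c a &
    dominated rho (N *+ 4) (fun a => c a - top_dual a).
Proof.
move=> hN; pose z m := iter m step top_dual.
have hz m : dominated rho (N / 2 ^+ m) (fun a => z m.+1 a - z m a).
  elim: m => [|m IH]; first by rewrite expr0 divr1.
  by have := step_contract IH; rewrite -mulrA -invfM exprSr.
have lim a : exists l : C, forall m, `|l - z m a| <= (N * rho ^+ mdeg a *+ 4) / 2 ^+ m.
  by apply: complex_geometric_limit => m; rewrite mulrAC hz.
have [c hc] := choice lim.
have hc' m : dominated rho (N *+ 4 / 2 ^+ m) (fun a => c a - z m a).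
  by move=> a; rewrite mulrAC mulrnAl.
exists c; last by have := hc' 0%N; rewrite expr0 divr1.
move=> a; apply/eqP; rewrite -subr_eq0; apply/eqP.
apply: (@le_geometric_eq0 _ _ (N * rho ^+ mdeg a *+ 4)) => m.
rewrite -(subrK (step (z m) a) (step c a)) -addrA.
apply: le_trans (ler_normD _ _) _.
rewrite (distrC _ (c a)) -[X in _ <= X]addr0.
have h1 := step_contract (hc' m) a.
have h2 := hc a m.+1.
apply: le_trans (lerD h1 h2) _.
rewrite addr0 exprS invfM le_eqVlt; apply/orP; left; apply/eqP.
have : (2 : C) ^+ m != 0 by rewrite expf_neq0 // pnatr_eq0.
by move=> h; field.
Qed.

(** By induction on j, using that the deformed powers commute: if x_i^(k+1) divides the
    monomial for some i < j, exchange x_i^(k+1) for - g_i in the defect of the j-th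
    relation.  The defect of the i-th relation is already zero, so the defect of the
    j-th one is bounded by half of any of its bounds. *)
Lemma step_fix_killed c N : dominated rho N c -> (forall a, step c a = c a) ->
  forall j a, act (deformed j) c a = 0.
Proof.
move=> hN fix_c j; have [l] := ubnP (val j); elim: l j => // l IH j jl.
have [B' hB'] : exists B', dominated rho B' (act (deformed j) c).
  have hD := op_boundD (@op_boundX R n rho (xpow j)) (@g_small j).
  by exists ((rho ^+ mdeg (xpow j) + rho ^+ k.+1 / 2) * N); apply: hD.
apply: (dominated_half _ hB') => N' hN' b.
have N0 := dominated_ge0 hN'.
have kj : (k < (b + xpow j)%MM j)%N.
  by rewrite mnmDE xpowE eqxx mul1n addnS ltnS leq_addl.
have := fix_c (b + xpow j)%MM; rewrite /step.
case: first_bigP => [i ki imin|red] fixb; last by have := red j; rewrite leqNgt kj.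
have [eij|ij] := eqVneq i j.
  move: fixb; rewrite eij addmK => fixb.
  rewrite actD actX -fixb addNr normr0 mulr_ge0 ?exprn_ge0 ?divr_ge0 //.
  exact: ltW.
have lij : (i < j)%N.
  rewrite ltn_neqAle -(inj_eq val_inj) in ij *; rewrite ij /= leqNgt.
  by apply/negP => /imin; rewrite leqNgt kj.
have kib : (k < b i)%N.
  by move: ki; rewrite mnmDE xpowE eq_sym (negbTE ij) mul0n addn0.
have -> : act (deformed j) c b = - act (g i) (act (deformed j) c) (b - xpow i)%MM.
  apply/eqP; rewrite -addr_eq0 -{1}(xpowK kib) -actX -actD -/(deformed i).
  rewrite act_commute (_ : act (deformed i) c = fun=> 0) ?act_zero //.
  by apply/funext => a; apply: IH; apply: leq_trans lij _.
by rewrite normrN act_g_small.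
Qed.

Variable K : P -> Prop.
Hypothesis K_deformed : forall j, K (deformed j).

(** K is the set of equations to be solved at a point; they contain the deformed
    powers, which is what makes their dual finite-dimensional. *)
Definition solution c :=
  (exists N, dominated rho N c) /\ (forall f, K f -> forall a, act f c a = 0).
Definition nonzero c := exists a, c a != 0.

Lemma nonzeroPn c : ~ nonzero c -> c = fun=> 0.
Proof.
by move=> h; apply/funext => a; apply/eqP/negPn/negP => ca; apply: h; exists a.
Qed.

Lemma solution_act f c : solution c -> solution (act f c).
Proof.
case=> [[N hN] kill]; split=> [|h Kh a].
  exists ((\sum_(e <- msupp f) `|f@_e| * rho ^+ mdeg e) * N).
  have -> : act f c = act (\sum_(e <- msupp f) f@_e *: 'X_[e]) c by rewrite -mpolyE.
  have := @op_bound_sum R n mon (msupp f) rho (fun e => f@_e *: 'X_[e]) _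
    (fun e => op_boundZ f@_e (@op_boundX R n rho e)).
  by apply.
rewrite act_commute (_ : act h c = fun=> 0) ?act_zero //.
by apply/funext => b; exact: kill.
Qed.

Lemma act_scale f z c a : act f (fun a => z * c a) a = z * act f c a.
Proof. by rewrite /act mulr_sumr; apply: eq_bigr => e _; rewrite mulrCA. Qed.

(** Peel the linear factors off one at a time: the last nonzero partial product applied
    to c is an eigenvector. *)
Lemma split_eigen j (r : seq C) c : nonzero c ->
  (forall a, act (\prod_(z <- r) ('X_j - z%:MP)) c a = 0) ->
  exists f z, nonzero (act f c) /\ forall a, act ('X_j - z%:MP) (act f c) a = 0.
Proof.
elim: r => [|z r IH] nz h.
  by case: nz => a; rewrite -[c a](act1 c) -(h a) big_nil eqxx.
have [nz'|/nonzeroPn z'] := pselect (nonzero (act (\prod_(z <- r) ('X_j - z%:MP)) c)).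
  by exists (\prod_(z <- r) ('X_j - z%:MP)), z; split=> // a; have := h a; rewrite big_cons actM.
by apply: IH nz _ => a; rewrite z'.
Qed.

Definition reduced_mon (u : {ffun 'I_n -> 'I_k.+1}) : mon := [multinom val (u i) | i < n].

Lemma reduced_monP a : reduced a -> exists u, a = reduced_mon u.
Proof.
move=> ra; exists [ffun i => inord (a i)]; apply/mnmP => i.
by rewrite mnmE ffunE /= inordK // ltnS.
Qed.

(** The restrictions of c, x_j c, x_j^2 c, ... to the reduced monomials are eventually
    linearly dependent, and solutions are determined by these restrictions. *)
Lemma annihilating_poly j c : solution c ->
  exists2 p : {poly C}, p != 0 & forall a, act (map_poly (@mpolyC n C) p).['X_j] c a = 0.
Proof.
move=> Sc; pose T := {ffun 'I_n -> 'I_k.+1}; pose D := #|{: T}|.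
pose A : 'M[C]_(D.+1, D) :=
  \matrix_(m, i) act ('X_j ^+ m) c (reduced_mon (enum_val i)).
have : kermx A != 0.
  by rewrite kermx_eq0 /row_free neq_ltn ltnS rank_leq_col.
case/rowV0Pn => v /sub_kermxP vA vn0; exists (\poly_(m < D.+1) v 0 (inord m)).
  apply: contraNneq vn0 => p0; apply/eqP/rowP => m.
  by have /polyP/(_ m) := p0; rewrite coef_poly ltn_ord coef0 mxE inord_val.
set p := \poly_(_ < _) _.
have pE a : act (map_poly (@mpolyC n C) p).['X_j] c a =
    \sum_(m < D.+1) v 0 m * act ('X_j ^+ m) c a.
  rewrite (horner_coef_wide _ (leq_trans (size_poly _ _ : (size (map_poly _ p) <= size p)%N) (size_poly _ _))) act_sum.
  by apply: eq_bigr => m _; rewrite coef_map /= mul_mpolyC actZ coef_poly ltn_ord inord_val.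
case: (solution_act (map_poly (@mpolyC n C) p).['X_j] Sc) => [[N hN] kill].
apply: (deformed_unique hN) => [i a|a /reduced_monP[u ->]].
  by apply: kill.
rewrite pE; have /rowP/(_ (enum_rank u)) := vA; rewrite !mxE => {2}<-.
by apply: eq_bigr => m _; rewrite mxE enum_rankK.
Qed.

Lemma eigen_one j c : solution c -> nonzero c ->
  exists f z, nonzero (act f c) /\ forall a, act ('X_j - z%:MP) (act f c) a = 0.
Proof.
move=> Sc nz; have [p p0 kill] := annihilating_poly j Sc.
have [r pE] := closed_field_poly_normal p; apply: (@split_eigen _ r) nz _ => a.
have /eqP := kill a; rewrite {1}pE map_polyZ hornerZ /= mul_mpolyC actZ.
rewrite mulf_eq0 lead_coef_eq0 (negbTE p0) /= => /eqP <-.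
rewrite rmorph_prod horner_prod; congr (act _ c a).
by apply: eq_bigr => z _; rewrite rmorphB /= map_polyX map_polyC hornerXsubC.
Qed.

Lemma eigen_all c (s : seq 'I_n) : solution c -> nonzero c ->
  exists f (p : 'I_n -> C), nonzero (act f c) /\
    forall j, j \in s -> forall a, act ('X_j - (p j)%:MP) (act f c) a = 0.
Proof.
move=> Sc nz; elim: s => [|j s [f [p [nzf kill]]]].
  by exists 1, (fun=> 0); split=> //; case: nz => a; exists a; rewrite act1.
have [f' [z [nz' kill']]] := eigen_one j (solution_act f Sc) nzf.
exists (f' * f), (fun i => if i == j then z else p i); rewrite actM; split=> // i.
rewrite inE; case: eqVneq => [-> _|_ /= si] a; first exact: kill'.
rewrite act_commute (_ : act _ (act f c) = fun=> 0) ?act_zero //.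
by apply/funext => b; apply: kill.
Qed.

(** A common eigenvector is a multiple of the evaluation at the point of eigenvalues. *)
Lemma act_character c (p : 'I_n -> C) :
  (forall j a, act ('X_j - (p j)%:MP) c a = 0) ->
  forall f a, act f c a = f.@[p] * c a.
Proof.
move=> kill; pose Q (f : P) := act f c = fun a => f.@[p] * c a.
have QM f f' : Q f -> Q f' -> Q (f * f').
  move=> hf hf'; rewrite /Q actM hf'; apply/funext => a.
  by rewrite act_scale hf mevalM; ring.
have Q1 : Q 1 by apply/funext => a; rewrite act1 meval1 mul1r.
have QX j : Q 'X_j.
  apply/funext => a; have /eqP := kill j a.
  by rewrite actB -[(p j)%:MP]mulr1 mul_mpolyC actZ act1 subr_eq0 mevalXU => /eqP.
have QXm m : Q 'X_[m].
  rewrite mpolyXE_id; elim/big_rec: _ => // j f _ hf; apply: (QM _ _ _ hf).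
  by elim: (m j) => [|l IH]; rewrite ?expr0 // exprS; apply: (QM).
move=> f a; rewrite {1 2}(mpolyE f) act_sum raddf_sum mulr_suml.
by apply: eq_bigr => e _; rewrite actZ QXm /= mevalZ mulrA.
Qed.

(** The eigenvalues are bounded because the values p_j^m of an evaluation on x_j^m must
    not outgrow rho^m; the factor 2 makes this a geometric growth argument. *)
Lemma solution_zero c : solution c -> nonzero c ->
  exists p : 'I_n -> C, (forall j, `|p j| <= rho *+ 2) /\ forall f, K f -> f.@[p] = 0.
Proof.
move=> Sc nz; have [f [p [nzf kill]]] := eigen_all (enum 'I_n) Sc nz.
have {}kill j a := kill j (mem_enum _ j) a.
have [[N hN] kills] := solution_act f Sc; clear Sc nz.
move: (act f c) nzf kill hN kills => {}c nz kill hN kills.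
have ev := act_character kill.
have c0 : c 0%MM != 0.
  case: nz => a; apply: contra => /eqP h.
  by rewrite -[a]add0m -actX ev h mulr0.
exists p; split=> [j|h Kh]; last first.
  by have /eqP := ev h 0%MM; rewrite kills // eq_sym mulf_eq0 (negbTE c0) orbF => /eqP.
rewrite real_leNgt ?normr_real ?ger0_real ?mulrn_wge0 //; last exact: ltW.
apply/negP => big; case/negP: c0; apply/eqP.
apply: (@le_geometric_eq0 _ _ N) => m.
have := hN (U_(j) *+ m)%MM; rewrite -[(_ *+ _)%MM]add0m -actX ev add0m.
rewrite -mpolyXn rmorphXn /= mevalXU mdegMn mdeg1 mul1n normrM normrX => le1.
have le2 : (rho *+ 2) ^+ m * `|c 0%MM| <= N * rho ^+ m.
  apply: le_trans le1; rewrite ler_wpM2r // lerXn2r ?nnegrE ?mulrn_wge0 //.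
  - exact: ltW.
  - exact: ltW.
rewrite ler_pdivlMr ?exprn_gt0 // -(ler_pM2r (exprn_gt0 m rho_gt0)).
rewrite [X in X <= _](_ : _ = (rho *+ 2) ^+ m * `|c 0%MM|) //.
by rewrite -[rho *+ 2]mulr_natr exprMn [RHS]mulrC [rho ^+ m * _]mulrC mulrA.
Qed.

End Deformation.

(** * Persistence of isolated zeros *)

Lemma cramer_row (T : comNzRingType) n (Z : 'M[T]_n) (x : 'I_n -> T) (i : 'I_n) :
  \det Z * x i = \sum_j (\adj Z) i j * \sum_l Z j l * x l.
Proof.
have adjZ l : \sum_j (\adj Z) i j * Z j l = \det Z *+ (i == l).
  by have /matrixP/(_ i l) := mul_adj_mx Z; rewrite [LHS]mxE [RHS]mxE.
under eq_bigr do rewrite mulr_sumr.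
rewrite exchange_big (bigD1 i) //= [X in _ + X]big1 ?addr0 => [|l li].
  by under eq_bigr do rewrite mulrA; rewrite -mulr_suml adjZ eqxx.
by under eq_bigr do rewrite mulrA; rewrite -mulr_suml adjZ eq_sym (negbTE li) mul0r.
Qed.

Lemma det_row_add (T : comNzRingType) n (A B C : 'M[T]_n) (i0 : 'I_n) :
  row i0 A = row i0 B + row i0 C -> row' i0 A = row' i0 B -> row' i0 A = row' i0 C ->
  \det A = \det B + \det C.
Proof.
move=> h hB hC; rewrite (@determinant_multilinear _ _ A B C i0 1 1) ?mul1r //.
by rewrite !scale1r.
Qed.

Section Persistence.
Import mpoly.
Variables (R : realType) (n : nat).
Local Notation C := R[i].
Local Notation P := {mpoly C[n]}.
Local Notation mon := 'X_{1..n}.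
Implicit Types (f U : P) (a : mon).

Lemma mcoeff_MX_eq0 f m a : ~~ (m <= a)%MM -> (f * 'X_[m])@_a = 0.
Proof.
move=> h; apply: memN_msupp_eq0; rewrite (perm_mem (msuppMX f m)).
by apply: contra h => /mapP[m' _ ->]; rewrite lem_addr.
Qed.

Lemma act_top_dual k f : act f (@top_dual R n k) 0%MM = f@_(top_mon n k).
Proof.
rewrite {2}(mpolyE f) raddf_sum; apply: eq_bigr => e _ /=.
by rewrite add0m /top_dual mcoeffZ mcoeffX.
Qed.

Lemma const0_decomp f : f@_0%MM = 0 -> exists u : 'I_n -> P, f = \sum_j u j * 'X_j.
Proof.
move=> f0; pose d (e : mon) : option 'I_n := [pick j | e j != 0%N].
exists (fun j => \sum_(e <- msupp f | d e == Some j) f@_e *: 'X_[e - U_(j)]).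
rewrite {1}(mpolyE f).
under [RHS]eq_bigr do rewrite mulr_suml.
rewrite (exchange_big_dep xpredT) //=; apply: eq_big_seq => e he.
case E: (d e) => [j|]; last first.
  rewrite big_pred0 //; have e0 : e = 0%MM.
    apply/mnmP => i; rewrite mnm0E; move: E; rewrite /d; case: pickP => // + _ => /(_ i).
    by move/negbFE/eqP.
  by rewrite e0 f0 scale0r.
rewrite (big_pred1 j) => [|i]; last by rewrite (inj_eq Some_inj) eq_sym.
rewrite -scalerAl -mpolyXD submK // lep1mP.
by move: E; rewrite /d; case: pickP => // i h [<-].
Qed.

(** If M x = (U x_j^(k+1))_j with U = 1 at the origin, then det M is congruent to x^top
    modulo the x_j^(k+1), as for the diagonal matrix D with entries U x_j^k, which is
    another choice of M.  Passing from D to M one row at a time, the i-th exchange adds a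
    determinant det Z where Z x has i-th entry 0, so by Cramer x_i det Z lies in the
    ideal of the x_j^(k+1) with j != i; hence so does det Z, and it has no coefficient
    at x^top. *)
Section SocleDeterminant.
Variables (k : nat) (U : P) (M : 'M[P]_n).
Hypothesis U1 : U@_0%MM = 1.
Hypothesis MX : forall j, \sum_l M j l * 'X_l = U * 'X_[xpow k j].

Let D : 'M[P]_n := \matrix_(j, l) ((U * 'X_[U_(j) *+ k]) *+ (j == l)).

Let DX j : \sum_l D j l * 'X_l = U * 'X_[xpow k j].
Proof.
rewrite (bigD1 j) //= big1 ?addr0 => [|l lj]; last first.
  by rewrite mxE eq_sym (negbTE lj) mul0r.
by rewrite mxE eqxx mulr1n -mulrA -mpolyXD /xpow mulmSr.
Qed.

Let mixed (i : nat) : 'M[P]_n :=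
  \matrix_(j, l) (if (j < i)%N then M j l else D j l).

Lemma socle_coeff_diag : (\det D)@_(top_mon n k) = 1.
Proof.
have -> : D = diag_mx (\row_j (U * 'X_[U_(j) *+ k])).
  by apply/matrixP => j l; rewrite !mxE.
rewrite det_diag; under eq_bigr do rewrite mxE.
rewrite big_split /= prodr_const mprodXE -[top_mon n k]addm0.
have -> : (\sum_(i < n) U_(i) *+ k)%MM = top_mon n k.
  apply/mnmP => i; rewrite mnm_sumE (bigD1 i) //= big1 ?addn0; last first.
    by move=> j ji; rewrite mulmnE mnm1E (negbTE ji).
  by rewrite mulmnE mnm1E eqxx mul1n mnmE.
by rewrite mcoeffMX rmorphXn /= U1 expr1n.
Qed.

Lemma socle_coeff_mixed i : (i <= n)%N -> (\det (mixed i))@_(top_mon n k) = 1.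
Proof.
elim: i => [_|i IH lin].
  by rewrite -socle_coeff_diag; congr (\det _)@_ _; apply/matrixP => j l; rewrite mxE.
pose i0 := Ordinal lin.
pose Z : 'M[P]_n := \matrix_(j, l) (if j == i0 then M j l - D j l else mixed i j l).
have mixedX j : \sum_l mixed i j l * 'X_l = U * 'X_[xpow k j].
  by under eq_bigr do rewrite mxE; case: (j < i)%N; rewrite ?MX ?DX.
have ZX j : \sum_l Z j l * 'X_l = if j == i0 then 0 else U * 'X_[xpow k j].
  under eq_bigr do rewrite mxE; case: (j == i0); last exact: mixedX.
  rewrite -[RHS](subrr (U * 'X_[xpow k j])) -{1}MX -DX -sumrB.
  by apply: eq_bigr => l _; rewrite mulrBl.
have mixedE i' j l : mixed i' j l = if (j < i')%N then M j l else D j l by rewrite mxE.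
have ZE j l : Z j l = if j == i0 then M j l - D j l else mixed i j l by rewrite mxE.
have rowE (A : 'M[P]_n) j l : row j A 0 l = A j l by rewrite mxE.
have row'E (A : 'M[P]_n) j j' l : row' j A j' l = A (lift j j') l by rewrite mxE.
have lift_i0 j : (lift i0 j == i0) = false by rewrite eq_sym (negbTE (neq_lift _ _)).
have lift_lt j : (lift i0 j < i.+1)%N = (lift i0 j < i)%N.
  by rewrite ltnS leq_eqVlt -[(_ == i)%N]/(lift i0 j == i0) lift_i0.
have coeffD (x y : P) m : x@_m = 1 -> y@_m = 0 -> (x + y)@_m = 1.
  by move=> hx hy; rewrite mcoeffD hx hy addr0.
have -> : \det (mixed i.+1) = \det (mixed i) + \det Z.
  apply: (@det_row_add _ _ _ _ _ i0).
  - apply/rowP => l; rewrite [RHS]mxE !rowE ZE eqxx !mixedE.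
    by rewrite ltnSn ltnn addrC subrK.
  - by apply/matrixP => j l; rewrite !row'E !mixedE lift_lt.
  - by apply/matrixP => j l; rewrite !row'E ZE lift_i0 !mixedE lift_lt.
apply: coeffD; first exact: IH (ltnW lin).
rewrite -(mcoeffMX _ U_(i0)).
have -> : \det Z * 'X_i0 = \sum_j (\adj Z) i0 j * (if j == i0 then 0 else U * 'X_[xpow k j]).
  rewrite (cramer_row Z (fun l => 'X_l)); apply: eq_bigr => j _.
  by congr (_ * _); rewrite ZX.
rewrite raddf_sum big1 //= => j _; case: eqVneq => [_|ji]; first by rewrite mulr0 mcoeff0.
rewrite mulrA mcoeff_MX_eq0 //; apply/mnm_lepP => /(_ j).
by rewrite xpowE mnmDE mnm1E eqxx mul1n [i0 == j]eq_sym (negbTE ji) add0n mnmE ltnn.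
Qed.

Lemma socle_coeff : (\det M)@_(top_mon n k) = 1.
Proof.
rewrite -(socle_coeff_mixed (leqnn n)); congr (\det _)@_ _.
by apply/matrixP => j l; rewrite mxE ltn_ord.
Qed.

End SocleDeterminant.

Lemma op_bound_choice (I : Type) (f : I -> P) : exists B : I -> C,
  forall i, 0 <= B i /\ forall rho, 0 <= rho <= 1 -> op_bound rho (f i) (B i).
Proof.
have h i : exists B, 0 <= B /\ forall rho, 0 <= rho <= 1 -> op_bound rho (f i) B.
  by have [B B0 hB] := op_bound_unif (f i); exists B.
by have [B hB] := choice h; exists B.
Qed.

Lemma op_bound_family (I : finType) (f : I -> P) : exists2 B : C, 0 <= B &
  forall rho, 0 <= rho <= 1 -> forall i, op_bound rho (f i) B.
Proof.
have [B hB] := op_bound_choice f.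
exists (\sum_i B i) => [|rho hrho i]; first by apply: sumr_ge0 => i _; case: (hB i).
have [_ /(_ rho hrho)] := hB i; apply: op_bound_le; first by case/andP: hrho.
by rewrite (bigD1 i) //= lerDl sumr_ge0 // => j _; case: (hB j).
Qed.

Lemma dominated_top_dual k (rho : C) : 0 < rho ->
  dominated rho (rho ^- mdeg (top_mon n k)) (@top_dual R n k).
Proof.
move=> r0 a; rewrite /top_dual; case: eqVneq => [->|_].
  by rewrite normr1 mulVf // expf_neq0 // gt_eqF.
by rewrite normr0 mulr_ge0 ?invr_ge0 ?exprn_ge0 // ltW.
Qed.

(** Here G is the perturbed system and Phi the determinant of a matrix A with F = A x.
    The radius rho makes U close to 1, and eta measures the perturbation relative to
    rho^(k+1). *)
Section PersistAtScale.
Variables (k : nat) (F G : 'I_n -> P) (h : 'M[P]_n) (U : P) (rho : C).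
Hypothesis rho_gt0 : 0 < rho.
Hypothesis hF : forall j, \sum_l h j l * F l = U * 'X_[xpow k j].
Variables (Phi : P) (eta Bphi : C).
Hypothesis U_small : op_bound rho (U - 1) (4^-1).
Hypothesis eta_ge0 : 0 <= eta.
Hypothesis eta_small : eta <= 4^-1.
Hypothesis G_small : forall j, op_bound rho (\sum_l h j l * (G l - F l)) (eta * rho ^+ k.+1).
Hypothesis Phi_bound : op_bound rho Phi Bphi.
Hypothesis Phi_top : (\det h * Phi)@_(top_mon n k) = 1.
Variable Bdet : C.
Hypothesis det_bound : op_bound rho (\det h) Bdet.
Hypothesis beat : Bdet * Bphi * (eta * rho ^- mdeg (top_mon n k) *+ 4) < 1.

Let g j : P := (U - 1) * 'X_[xpow k j] + \sum_l h j l * (G l - F l).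

Let gE j : deformed k g j = \sum_l h j l * G l.
Proof.
rewrite /deformed /g addrA mulrBl mul1r [X in X + _]addrC subrK -hF -big_split /=.
by apply: eq_bigr => l _; rewrite -mulrDr [F l + _]addrC subrK.
Qed.

Let g_small j : op_bound rho (g j) (rho ^+ k.+1 / 2).
Proof.
have r0 := ltW rho_gt0.
have mx : mdeg (xpow k j) = k.+1 by rewrite /xpow mdegMn mdeg1 mul1n.
have := op_boundD (op_boundM U_small (@op_boundX R n rho (xpow k j))) (@G_small j).
apply: op_bound_le => //; rewrite mx.
rewrite -mulrDl mulrC ler_wpM2l ?exprn_ge0 //.
apply: le_trans (lerD (lexx _) eta_small) _; rewrite le_eqVlt; apply/orP; left.
by apply/eqP; field.
Qed.

Lemma persist_at_scale : exists p : 'I_n -> C,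
  (forall j, `|p j| <= rho *+ 2) /\ forall l, (G l).@[p] = 0.
Proof.
pose N0 := rho ^- mdeg (top_mon n k).
have top0 j b : @top_dual R n k (b + xpow k j)%MM = 0 :> C.
  rewrite /top_dual; case: eqP => // /mnmP/(_ j); rewrite mnmDE xpowE eqxx mnmE mul1n.
  by move/eqP; rewrite addnS gtn_eqF // ltnS leq_addl.
have step0 : dominated rho (eta * N0) (fun a => step k g (@top_dual R n k) a - @top_dual R n k a).
  move=> a; have N0ge : 0 <= eta * N0 by rewrite mulr_ge0 ?invr_ge0 ?exprn_ge0 // ltW.
  rewrite /step; case: first_bigP => [j aj _|ra]; last first.
    by rewrite subrr normr0 mulr_ge0 ?exprn_ge0 // ltW.
  rewrite -{2}(xpowK aj) top0 subr0 normrN /g actD actM.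
  rewrite (_ : act 'X_[xpow k j] _ = fun=> 0) ?act_zero ?add0r; last first.
    by apply/funext => b; rewrite actX top0.
  apply: le_trans (G_small j (dominated_top_dual k rho_gt0) (a - xpow k j)%MM) _.
  by rewrite (mdeg_xpow aj) exprD [X in X <= _](_ : _ = eta * N0 *
    (rho ^+ k.+1 * rho ^+ mdeg (a - xpow k j)%MM)) // mulrA (mulrAC eta) /N0.
have [c cfix cN] := step_fixpoint rho_gt0 g_small step0.
have [N hN] : exists N, dominated rho N c.
  exists (eta * N0 *+ 4 + N0) => a; rewrite -[c a](subrK (@top_dual R n k a)) mulrDl.
  by apply: le_trans (ler_normD _ _) _; rewrite lerD ?cN ?dominated_top_dual.
have kill := step_fix_killed rho_gt0 g_small hN cfix.
pose K f := (exists j, f = deformed k g j) \/ (exists l, f = G l).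
have KG j : K (deformed k g j) by left; exists j.
have sol : solution rho K (act (\det h) c).
  split; first by exists (Bdet * N); apply: det_bound.
  move=> f [[j ->]|[l ->]] a.
    by rewrite act_commute (_ : act (deformed k g j) c = fun=> 0) ?act_zero //; apply/funext.
  rewrite -actM mulrC (cramer_row h G l) act_sum big1 // => j _.
  by rewrite -gE actM (_ : act (deformed k g j) c = fun=> 0) ?act_zero //; apply/funext.
have nz : nonzero (act (\det h) c).
  apply/not_existsP => z; have /(_ 0%MM) := op_boundM det_bound Phi_bound cN.
  rewrite act_sub act_top_dual Phi_top mulrC actM (_ : act _ c = fun=> 0); last first.
    by apply/funext => a; apply/eqP/negPn/negP; apply: z.
  rewrite act_zero sub0r normrN normr1 mdeg0 expr0 mulr1 => /le_lt_trans/(_ beat).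
  by rewrite ltxx.
have [p [p_small pz]] := solution_zero rho_gt0 g_small KG sol nz.
by exists p; split=> // l; apply: pz; right; exists l.
Qed.

End PersistAtScale.

Lemma le_inv_bound (x s : C) : x <= s -> 0 < s -> s^-1 * x <= 1.
Proof. by move=> xs s0; rewrite mulrC ler_pdivrMr ?mul1r. Qed.

(** The radius is chosen first, so that U - 1 is small and the polydisc of radius
    2 rho has its points bounded by delta; then eps, so that the perturbation is too
    small to move the value 1 of the socle determinant to 0. *)
Lemma zeros_persist (k : nat) (F : 'I_n -> P) (h : 'M[P]_n) (U : P) (G : 'I_n -> P) :
  (forall l, (F l)@_0%MM = 0) -> U@_0%MM = 1 ->
  (forall j, \sum_l h j l * F l = U * 'X_[xpow k j]) ->
  forall delta : C, 0 < delta -> exists2 eps : C, 0 < eps &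
  forall tau : 'I_n -> C, (forall l, `|tau l| <= eps) ->
  exists p : 'I_n -> C, (forall j, `|p j| <= delta) /\
    forall l, (F l + tau l *: G l).@[p] = 0.
Proof.
move=> F0 U1 hF delta delta0.
have [A FA] : exists A : 'M[P]_n, forall l, F l = \sum_j A l j * 'X_j.
  have [A hA] := choice (fun l => const0_decomp (F0 l)).
  by exists (\matrix_(l, j) A l j) => l; rewrite hA; apply: eq_bigr => j _; rewrite mxE.
have socle : (\det h * \det A)@_(top_mon n k) = 1.
  have <- : \det (h *m A) = \det h * \det A := det_mulmx h A.
  apply: (socle_coeff U1) => j; rewrite -hF.
  transitivity (\sum_l \sum_i h j i * (A i l * 'X_l)).
    apply: eq_bigr => l _; rewrite mxE mulr_suml.
    by apply: eq_bigr => i _; rewrite mulrA.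
  by rewrite exchange_big; apply: eq_bigr => i _; rewrite FA mulr_sumr.
have [v Uv] : exists v : 'I_n -> P, U - 1 = \sum_j v j * 'X_j.
  by apply: const0_decomp; rewrite mcoeffB mcoeff1 eqxx U1 subrr.
have [Bv Bv0 hBv] := op_bound_family v.
have [B1 B10 hB1] := op_bound_family (fun jl : 'I_n * 'I_n => h jl.1 jl.2 * G jl.2).
have [Bphi Bphi0 hBphi] := op_bound_unif (\det A).
have [Bdet Bdet0 hBdet] := op_bound_unif (\det h).
(* s^-1 is at most 1, makes the bound n Bv rho of U - 1 at most 1/4, and 2 rho <= delta *)
pose s := 1 + n%:R * Bv * 4 + delta^-1 *+ 2.
have s1 : 0 <= n%:R * Bv * 4 by rewrite !mulr_ge0.
have s2 : 0 <= delta^-1 *+ 2 by rewrite mulrn_wge0 // invr_ge0 ltW.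
have s_gt0 : 0 < s by rewrite /s -addrA ltr_wpDr ?ltr01 // addr_ge0.
pose rho := s^-1; have rho0 : 0 < rho by rewrite invr_gt0.
have rho1 : 0 <= rho <= 1.
  rewrite ltW //= -[rho]mulr1 le_inv_bound // /s -addrA lerDl addr_ge0 //.
have rhoU : n%:R * Bv * rho <= 4^-1.
  have : rho * (n%:R * Bv * 4) <= 1.
    by apply: le_inv_bound => //; rewrite /s addrAC lerDr addr_ge0.
  by rewrite mulrA -ler_pdivlMr // mul1r mulrC.
have rhod : rho *+ 2 <= delta.
  have : rho * (delta^-1 *+ 2) <= 1 by apply: le_inv_bound => //; rewrite /s lerDr addr_ge0.
  by rewrite mulrnAr -mulrnAl ler_pdivrMr // mul1r.
pose rK := rho ^- k.+1; pose rT := rho ^- mdeg (top_mon n k).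
have rK0 : 0 <= rK by rewrite invr_ge0 exprn_ge0 // ltW.
have rT0 : 0 <= rT by rewrite invr_ge0 exprn_ge0 // ltW.
(* u1 <= w makes eta <= 1/4; u2 < w keeps the socle value away from 0 *)
pose u1 := n%:R * B1 * rK * 4.
pose u2 := Bdet * Bphi * (n%:R * B1 * rK * rT *+ 4).
have u10 : 0 <= u1 by rewrite !mulr_ge0.
have u20 : 0 <= u2 by rewrite !mulr_ge0 ?mulrn_wge0 ?mulr_ge0.
pose w := 1 + u1 + u2; have w0 : 0 < w by rewrite /w -addrA ltr_wpDr ?ltr01 // addr_ge0.
exists w^-1 => [|tau tau_small]; first by rewrite invr_gt0.
have eps0 : 0 <= w^-1 by rewrite invr_ge0 ltW.
pose eta := n%:R * B1 * w^-1 * rK.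
have eta0 : 0 <= eta by rewrite !mulr_ge0.
have eta4 : eta <= 4^-1.
  have : w^-1 * u1 <= 1 by apply: le_inv_bound => //; rewrite /w addrAC lerDr addr_ge0.
  rewrite /u1 mulrA -ler_pdivlMr // mul1r; congr (_ <= _).
  by rewrite /eta [RHS]mulrAC [LHS]mulrC.
have beat : Bdet * Bphi * (eta * rT *+ 4) < 1.
  have : w^-1 * u2 < 1 by rewrite mulrC ltr_pdivrMr // mul1r /w ltrDr ltr_wpDr ?ltr01.
  by congr (_ < _); rewrite /u2 /eta; ring.
have hU : op_bound rho (U - 1) 4^-1.
  rewrite Uv; have := op_bound_sum (index_enum 'I_n)
    (fun j => op_boundM (hBv rho rho1 j) (@op_boundX R n rho U_(j))).
  apply: op_bound_le; first exact: ltW.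
  by under eq_bigr do rewrite mdeg1 expr1; rewrite sumr_const card_ord -[_ *+ n]mulr_natl mulrA.
have hG j : op_bound rho (\sum_l h j l * ((F l + tau l *: G l) - F l)) (eta * rho ^+ k.+1).
  have -> : \sum_l h j l * ((F l + tau l *: G l) - F l) = \sum_l tau l *: (h j l * G l).
    by apply: eq_bigr => l _; rewrite addrC addKr scalerAr.
  have := op_bound_sum (index_enum 'I_n)
    (fun l => op_boundZ (tau l) (hB1 rho rho1 (j, l))).
  apply: op_bound_le; first exact: ltW.
  rewrite /eta -mulrA /rK mulVf ?expf_neq0 ?gt_eqF // mulr1 -mulrA mulr_natl.
  rewrite -[X in _ <= _ *+ X]card_ord -sumr_const; apply: ler_sum => l _.
  by rewrite mulrC ler_wpM2l.
have [p [psmall pz]] := persist_at_scale rho0 hF hU eta0 eta4 hG (hBphi rho rho1)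
  socle (hBdet rho rho1) beat.
by exists p; split=> // j; apply: le_trans rhod.
Qed.

End Persistence.

(** * Ideals of root matchings *)

Section MatchingIdeals.
Import mpoly.
Variables (R : realType) (n : nat).
Local Notation C := R[i].
Local Notation P := {mpoly C[n]}.
Implicit Types (J : P -> Prop) (f g : P).

Definition is_ideal J :=
  [/\ J 0, forall f g, J f -> J g -> J (f + g) & forall f g, J g -> J (f * g)].

Definition adjoin J f : P -> Prop := fun g => exists j s, J j /\ g = j + s * f.

(** J contains U m^k, where m is the ideal of the origin: the algebraic form of the
    statement that the origin is an isolated zero of J, or not a zero of it. *)
Definition isolated_origin J := exists U k, U@_0%MM != 0 /\
  forall js : seq 'I_n, size js = k -> J (U * \prod_(j <- js) 'X_j).

Lemma adjoin_ideal J f : is_ideal J -> is_ideal (adjoin J f).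
Proof.
case=> J0 JD JM; split.
- by exists 0, 0; rewrite mul0r addr0.
- move=> _ _ [j [s [hj ->]]] [j' [s' [hj' ->]]]; exists (j + j'), (s + s').
  by split; [exact: JD|rewrite mulrDl addrACA].
- move=> g _ [j [s [hj ->]]]; exists (g * j), (g * s).
  by split; [exact: JM|rewrite mulrDr mulrA].
Qed.

Lemma sub_adjoin J f g : J g -> adjoin J f g.
Proof. by move=> Jg; exists g, 0; rewrite mul0r addr0. Qed.

Lemma mem_adjoin J f : is_ideal J -> adjoin J f f.
Proof. by case=> J0 _ _; exists 0, 1; rewrite mul1r add0r. Qed.

Lemma isolated_origin_sub J J' :
  (forall f, J f -> J' f) -> isolated_origin J -> isolated_origin J'.
Proof. by move=> sub [U [k [U0 h]]]; exists U, k; split=> // js /h/sub. Qed.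

Lemma isolated_origin_unit J f : f@_0%MM != 0 -> is_ideal J -> J f -> isolated_origin J.
Proof.
move=> f0 [_ _ JM] Jf; exists f, 0%N; split=> // js _.
by rewrite mulrC; apply: JM.
Qed.

(** Multiply an element of J + (f) by an element of J + (g). *)
Lemma isolated_origin_mul J f g : is_ideal J -> J (f * g) ->
  isolated_origin (adjoin J f) -> isolated_origin (adjoin J g) -> isolated_origin J.
Proof.
move=> idJ Jfg [U [k [U0 hU]]] [W [l [W0 hW]]].
exists (U * W), (k + l)%N; split=> [|js sz].
  by rewrite (rmorphM (mcoeff 0%MM)) mulf_neq0.
have /hU[j [s [hj e]]] : size (take k js) = k.
  by rewrite size_takel // sz leq_addr.
have /hW[j' [s' [hj' e']]] : size (drop k js) = l.
  by rewrite size_drop sz addKn.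
rewrite -(cat_take_drop k js) big_cat /= mulrACA e e'.
case: idJ => J0 JD JM.
rewrite mulrDl; apply: (JD); first by rewrite mulrC; apply: JM.
rewrite mulrDr; apply: (JD); first by apply: JM.
by rewrite mulrACA; apply: JM.
Qed.

Lemma isolated_origin_prod J (fs : seq P) : is_ideal J -> J (\prod_(f <- fs) f) ->
  (forall f, f \in fs -> isolated_origin (adjoin J f)) -> isolated_origin J.
Proof.
elim: fs J => [|f fs IH] J idJ; rewrite ?big_nil ?big_cons => Jp iso.
  by apply: isolated_origin_unit idJ Jp; rewrite mcoeff1 eqxx oner_neq0.
apply: (isolated_origin_mul idJ Jp); first by apply: iso; rewrite mem_head.
have idJ' := adjoin_ideal (\prod_(f <- fs) f) idJ.
apply: IH (idJ') (mem_adjoin _ idJ) _ => g gs.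
have := iso g; rewrite inE gs orbT => /(_ isT); apply: isolated_origin_sub.
by move=> h [j [s [hj ->]]]; exists j, s; split=> //; apply: sub_adjoin.
Qed.

Definition coefs_in J (p : {poly P}) := forall k, J p`_k.

Lemma coefs_in_horner J p a : is_ideal J -> coefs_in J p -> J p.[a].
Proof.
case=> J0 JD JM h; rewrite horner_coef; elim/big_ind: _ => // i _.
by rewrite mulrC; apply: JM.
Qed.

Lemma coefs_in_divX J (p : {poly P}) a :
  is_ideal J -> coefs_in J (('X - a%:P) * p) -> coefs_in J p.
Proof.
case=> J0 JD JM h k; have [l] := ubnP (size p - k).
elim: l k => // l IH k lk; have [kp|kp] := leqP (size p) k; first by rewrite nth_default.
have -> : p`_k = (('X - a%:P) * p)`_k.+1 + a * p`_k.+1.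
  by rewrite mulrBl coefB coefXM coefCM /= subrK.
apply: (JD); first exact: h; apply: (JM); apply: IH.
by apply: leq_trans (_ : size p - k <= l)%N; rewrite // ltn_sub2l.
Qed.

Definition root_prod (T : comNzRingType) (s : seq T) : {poly T} :=
  \prod_(a <- s) ('X - a%:P).

(** Evaluating prod ('X - a_l) - prod ('X - b_m) at 'X = a_1 puts prod_m (a_1 - b_m) in
    J.  Modulo a_1 - b_m, the factor 'X - a_1 can be cancelled from the difference of
    the two products, and the remaining roots are matched in the same way. *)
Lemma isolated_origin_match_one J (as_ bs : seq P) :
  size as_ = size bs -> is_ideal J -> coefs_in J (root_prod as_ - root_prod bs) ->
  (forall J' bs', is_ideal J' -> (forall f, J f -> J' f) -> perm_eq bs' bs ->
     (forall l, (l < size as_)%N -> J' (as_`_l - bs'`_l)) -> isolated_origin J') ->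
  isolated_origin J.
Proof.
elim: as_ bs J => [|a as_ IH] bs J sz idJ cJ iso; first by apply: (iso J bs).
have Jprod : J (\prod_(f <- [seq a - b | b <- bs]) f).
  have := coefs_in_horner a idJ cJ; case: (idJ) => _ _ JM /(JM (-1)).
  rewrite mulN1r hornerD hornerN /root_prod big_cons hornerM hornerXsubC subrr mul0r.
  rewrite add0r opprK horner_prod big_map.
  by under eq_bigr do rewrite hornerXsubC.
apply: (isolated_origin_prod idJ Jprod) => _ /mapP[b bbs ->].
have idJ' := adjoin_ideal (a - b) idJ.
apply: (IH (rem b bs) _ _ idJ') => [||J' bs' idJ'' sub perm hJ'].
- by rewrite size_rem // -sz.
- apply: (coefs_in_divX (a := a) idJ') => k.
  have -> : ('X - a%:P) * (root_prod as_ - root_prod (rem b bs)) =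
      (root_prod (a :: as_) - root_prod bs) + (a - b)%:P * root_prod (rem b bs).
    rewrite /root_prod (perm_big _ (perm_to_rem bbs)) /= !big_cons !polyCB; ring.
  rewrite coefD coefCM; case: (idJ') => _ JD JM; apply: (JD).
    exact/sub_adjoin/cJ.
  by rewrite mulrC; apply: (JM); apply: mem_adjoin.
- apply: (iso J' (b :: bs')) => // [f Jf||[|l] ll].
  + by apply/sub/sub_adjoin.
  + by rewrite perm_sym (perm_trans (perm_to_rem bbs)) // perm_cons perm_sym.
  + by apply/sub/mem_adjoin.
  + exact: hJ'.
Qed.

Lemma isolated_origin_match (I : finType) J (as_ bs : I -> seq P) :
  (forall i, size (as_ i) = size (bs i)) -> is_ideal J ->
  (forall i, coefs_in J (root_prod (as_ i) - root_prod (bs i))) ->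
  (forall J' bs', is_ideal J' -> (forall i, perm_eq (bs' i) (bs i)) ->
     (forall i l, (l < size (as_ i))%N -> J' ((as_ i)`_l - (bs' i)`_l)) ->
     isolated_origin J') ->
  isolated_origin J.
Proof.
move=> sz idJ cJ iso.
have gen (s : seq I) J0 : is_ideal J0 -> (forall f, J f -> J0 f) ->
   (forall J' bs', is_ideal J' -> (forall f, J0 f -> J' f) ->
     (forall i, i \in s -> perm_eq (bs' i) (bs i) /\
       forall l, (l < size (as_ i))%N -> J' ((as_ i)`_l - (bs' i)`_l)) ->
     isolated_origin J') -> isolated_origin J0.
  elim: s J0 => [|i s IH] J0 idJ0 sub0 H; first exact: (H J0 bs).
  apply: (isolated_origin_match_one (sz i) idJ0) => [k|J1 b1 idJ1 sub1 perm1 h1].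
    exact/sub0/cJ.
  apply: IH => // [f /sub0/sub1 //|J2 bs2 idJ2 sub2 h2].
  apply: (H J2 (fun i' => if i' == i then b1 else bs2 i')) => // [f /sub1/sub2 //|i'].
  rewrite inE; case: eqVneq => [-> _|_ /h2 //]; split=> // l /h1; exact: sub2.
apply: (gen (enum I) J) => // J' bs' idJ' _ h; apply: (iso J' bs') => // i.
  by case: (h i); rewrite ?mem_enum.
by case: (h i); rewrite ?mem_enum.
Qed.

Definition affine_form (c : C) (a : 'I_n -> C) : P := c%:MP + \sum_j a j *: 'X_j.

(** Either some form does not vanish at the origin, and is itself a unit there; or the
    forms are linear and span all the x_j; or they vanish on a common line. *)
Lemma isolated_origin_affine J (f : 'I_n -> P) : is_ideal J ->
  (forall v, J (f v)) -> (forall v, exists c a, f v = affine_form c a) ->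
  isolated_origin J \/ exists2 y : 'I_n -> C, (exists j, y j != 0) &
    forall t v, (f v).@[fun j => t * y j] = 0.
Proof.
move=> idJ Jf aff; have [c hc] := choice aff; have [a ha] := choice hc.
have aff0 v : (f v)@_0%MM = c v.
  rewrite ha mcoeffD mcoeffC eqxx mulr1 raddf_sum big1 ?addr0 //= => j _.
  by rewrite mcoeffZ mcoeffX mnm1_eq0 mulr0.
have [c0|/existsNP[v /eqP cv]] := pselect (forall v, c v = 0); last first.
  by left; apply: (@isolated_origin_unit _ (f v)) => //; rewrite aff0.
pose A : 'M[C]_n := \matrix_(v, j) a v j.
have fE v : f v = \sum_j A v j *: 'X_j.
  by rewrite ha /affine_form c0 mpolyC0 add0r; apply: eq_bigr => j _; rewrite mxE.
have [Au|An] := boolP (A \in unitmx).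
  left; exists 1, 1%N; split=> [|[|j []] // _]; first by rewrite mcoeff1 eqxx oner_neq0.
  case: idJ => J0 JD JM.
  rewrite mul1r big_seq1; have -> : 'X_j = \sum_v (invmx A j v)%:MP * f v.
    transitivity (\sum_l (1%:M : 'M[C]_n) j l *: ('X_l : P)).
      rewrite (bigD1 j) //= big1 ?addr0 => [|l lj]; rewrite mxE ?eqxx ?scale1r //.
      by rewrite eq_sym (negbTE lj) scale0r.
    under [RHS]eq_bigr do rewrite mul_mpolyC fE scaler_sumr.
    rewrite exchange_big; apply: eq_bigr => l _; rewrite -(mulVmx Au) mxE scaler_suml.
    by apply: eq_bigr => v _; rewrite scalerA.
  by elim/big_ind: _ => // v _; apply: JM.
right; have : kermx A^T != 0 by rewrite kermx_eq0 row_free_unit unitmx_tr.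
case/rowV0Pn => y /sub_kermxP yA y0.
exists (fun j => y 0 j).
  apply/not_existsP => h; case/eqP: y0; apply/rowP => j; rewrite mxE.
  by apply/eqP/negPn/negP; apply: h.
move=> t v; rewrite fE raddf_sum /= -[RHS](mulr0 t).
have /rowP/(_ v) := yA; rewrite !mxE => {2}<-; rewrite mulr_sumr.
by apply: eq_bigr => j _; rewrite mevalZ mevalXU !mxE mulrCA [_ * a _ _]mulrC.
Qed.

End MatchingIdeals.

(** * Systems equating multisets of affine roots *)

Lemma size_root_prod_sub (T : comNzRingType) (s s' : seq T) :
  size s = size s' -> (size (root_prod s - root_prod s')%R <= size s)%N.
Proof.
move=> ss.
have lead (u : seq T) : (root_prod u)`_(size u) = 1.
  have /monicP := monic_prod_XsubC u xpredT id.
  by rewrite lead_coefE /root_prod size_prod_XsubC.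
apply/leq_sizeP => j; rewrite leq_eqVlt => /predU1P[<-|sj].
  by rewrite coefB lead ss lead subrr.
rewrite nth_default //; apply: leq_trans (size_polyD _ _) _.
by rewrite size_polyN geq_max /root_prod !size_prod_XsubC -ss sj.
Qed.

(** Affine functionals x |-> c + \sum_v a_v x_v, as pairs (c, a). *)
Definition affine (T : Type) (V : Type) := (T * (V -> T))%type.
Definition affine_eval (T : comNzRingType) (V : finType) (f : affine T V) (x : V -> T) : T :=
  f.1 + \sum_v f.2 v * x v.

Definition root_poly (T : comNzRingType) (V : finType) (s : seq (affine T V)) (x : V -> T) :
  {poly T} := root_prod [seq affine_eval f x | f <- s].

Section RootPolynomials.
Variables (R : idomainType) (V : finType).
Implicit Types (s : seq (affine R V)) (x : V -> R).

Lemma root_polyE s x : root_poly s x = \prod_(f <- s) ('X - (affine_eval f x)%:P).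
Proof. by rewrite /root_poly /root_prod big_map. Qed.

Lemma root_poly_cat s s' x : root_poly (s ++ s') x = root_poly s x * root_poly s' x.
Proof. by rewrite !root_polyE big_cat. Qed.

Lemma root_poly_flatten (ss : seq (seq (affine R V))) x :
  root_poly (flatten ss) x = \prod_(s <- ss) root_poly s x.
Proof.
elim: ss => [|s ss IH]; first by rewrite root_polyE !big_nil.
by rewrite /= root_poly_cat IH big_cons.
Qed.

Lemma root_poly_monic s x : root_poly s x \is monic.
Proof. by rewrite root_polyE monic_prod_XsubC. Qed.

Lemma size_root_poly s x : size (root_poly s x) = (size s).+1.
Proof. by rewrite root_polyE size_prod_XsubC. Qed.

Lemma root_poly_root n (F : 'I_n -> affine R V) l x :
  (root_poly [seq F l | l <- fintype.enum 'I_n] x).[affine_eval (F l) x] = 0.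
Proof.
rewrite root_polyE big_map big_enum horner_prod (bigD1 l) //=.
by rewrite hornerXsubC subrr mul0r.
Qed.

End RootPolynomials.

(** The equations state that the roots as_ i x and bs i x coincide as multisets.  They
    are as many as the unknowns, which are indexed by the left-hand roots. *)
Section RootSystems.
Import mpoly.
Variables (R : realType) (I : finType) (N : I -> nat).
Local Notation C := R[i].
Local Notation V := {i : I & 'I_(N i)}.
Local Notation n := #|{: V}|.
Local Notation P := {mpoly C[n]}.
Variables (as_ bs cs : I -> seq (affine C V)).
Hypothesis size_as : forall i, size (as_ i) = N i.
Hypothesis size_bs : forall i, size (bs i) = N i.
Hypothesis size_cs : forall i, size (cs i) = N i.

Definition root_eq i x := root_poly (as_ i) x - root_poly (bs i) x.

Hypothesis root_eq0 : forall i, root_eq i (fun=> 0) = 0.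
Hypothesis no_line : forall y : V -> C, (exists v, y v != 0) ->
  ~ forall (t : C) i, root_eq i (fun v => t * y v) = 0.

Let lift_affine (f : affine C V) : P := affine_form f.1 (fun j => f.2 (enum_val j)).
Let at_point (x : V -> C) (j : 'I_n) : C := x (enum_val j).

Let lift_affine_eval f x : (lift_affine f).@[at_point x] = affine_eval f x.
Proof.
rewrite /lift_affine /affine_form mevalD mevalC raddf_sum /=; congr (_ + _).
rewrite [RHS](reindex _ (onW_bij _ (enum_val_bij _))) /=.
by apply: eq_bigr => j _; rewrite mevalZ mevalXU.
Qed.

Let mas i : seq P := map lift_affine (as_ i).
Let mbs i : seq P := map lift_affine (bs i).
Let mcs i : seq P := map lift_affine (cs i).

Let map_root_prod (T T' : comNzRingType) (phi : {rmorphism T -> T'}) (s : seq T) :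
  map_poly phi (root_prod s) = root_prod (map phi s).
Proof.
rewrite /root_prod rmorph_prod big_map; apply: eq_bigr => a _.
by rewrite rmorphB /= map_polyX map_polyC.
Qed.

Let meval_root_prod (s : seq (affine C V)) x :
  map_poly (meval (at_point x)) (root_prod (map lift_affine s)) = root_poly s x.
Proof.
rewrite map_root_prod -map_comp; congr root_prod.
by apply: eq_map => f /=; rewrite lift_affine_eval.
Qed.

Let meq i : {poly P} := root_prod (mas i) - root_prod (mbs i).

Let meq_eval i x : map_poly (meval (at_point x)) (meq i) = root_eq i x.
Proof. by rewrite rmorphB /= !meval_root_prod. Qed.

Let F (l : 'I_n) : P := let v := enum_val l in (meq (tag v))`_(tagged v).

Let FE i (k : 'I_(N i)) : F (enum_rank (Tagged (fun i => 'I_(N i)) k)) = (meq i)`_k.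
Proof. by rewrite /F enum_rankK. Qed.

Let generated (f : P) := exists c : 'I_n -> P, f = \sum_l c l * F l.

Let generated_ideal : is_ideal generated.
Proof.
split.
- by exists (fun=> 0); rewrite big1 // => l _; rewrite mul0r.
- move=> _ _ [c ->] [d ->]; exists (fun l => c l + d l).
  by rewrite -big_split; apply: eq_bigr => l _; rewrite mulrDl.
- move=> f _ [c ->]; exists (fun l => f * c l).
  by rewrite mulr_sumr; apply: eq_bigr => l _; rewrite mulrA.
Qed.

Let generated_coefs i : coefs_in generated (meq i).
Proof.
case: generated_ideal => J0 _ _ k; have [kN|kN] := leqP (N i) k.
  rewrite nth_default //; apply: leq_trans (size_root_prod_sub _) _.
    by rewrite !size_map size_as size_bs.
  by rewrite size_map size_as.
pose l := enum_rank (Tagged (fun i => 'I_(N i)) (Ordinal kN)).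
exists (fun l' => (l' == l)%:R); rewrite (bigD1 l) //= big1 ?addr0 => [|l' /negbTE->].
  by rewrite eqxx mul1r FE.
by rewrite mul0r.
Qed.

Let lift_affineB f g : exists c a, lift_affine f - lift_affine g = affine_form c a.
Proof.
exists (f.1 - g.1), (fun j => f.2 (enum_val j) - g.2 (enum_val j)).
rewrite /lift_affine /affine_form mpolyCB opprD addrACA -sumrB; congr (_ + _).
by apply: eq_bigr => j _; rewrite scalerBl.
Qed.

(** A line on which some matching of roots holds identically is a line of zeros. *)
Lemma root_eqs_isolated : isolated_origin generated.
Proof.
apply: (isolated_origin_match (as_ := mas) (bs := mbs)) generated_ideal generated_coefs _.
  by move=> i; rewrite !size_map size_as size_bs.
move=> J bs' idJ perm hJ.
pose f (l : 'I_n) := let v := enum_val l in (mas (tag v))`_(tagged v) - (bs' (tag v))`_(tagged v).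
have fE i (k : nat) (kN : (k < N i)%N) :
    f (enum_rank (Tagged (fun i => 'I_(N i)) (Ordinal kN))) = (mas i)`_k - (bs' i)`_k.
  by rewrite /f enum_rankK.
have Jf l : J (f l) by apply: hJ; rewrite size_map size_as ltn_ord.
have aff l : exists c a, f l = affine_form c a.
  rewrite /f /=; set v := enum_val l.
  have [u1 ->] : exists g, (mas (tag v))`_(tagged v) = lift_affine g.
    have : (mas (tag v))`_(tagged v) \in mas (tag v).
      by rewrite mem_nth // size_map size_as ltn_ord.
    by case/mapP => g _ ->; exists g.
  have [u2 ->] : exists g, (bs' (tag v))`_(tagged v) = lift_affine g.
    have : (bs' (tag v))`_(tagged v) \in mbs (tag v).
      rewrite -(perm_mem (perm (tag v))) mem_nth //.
      by rewrite (perm_size (perm _)) size_map size_bs ltn_ord.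
    by case/mapP => g _ ->; exists g.
  exact: lift_affineB.
have [//|[y [l yl] fy]] := isolated_origin_affine idJ Jf aff.
case: (no_line (y := fun v => y (enum_rank v))) => [|t i].
  by exists (enum_val l); rewrite enum_valK.
rewrite -meq_eval rmorphB /= (_ : at_point _ = fun j => t * y j); last first.
  by apply/funext => j; rewrite /at_point enum_valK.
apply/eqP; rewrite subr_eq0; apply/eqP.
have -> : root_prod (mbs i) = root_prod (bs' i) by apply: perm_big; rewrite perm_sym.
rewrite !map_root_prod; congr root_prod; apply: (@eq_from_nth _ 0).
  by rewrite !size_map (perm_size (perm i)) size_map size_as size_bs.
move=> k; rewrite !size_map size_as => kN.
rewrite !(nth_map 0) ?size_map ?size_as //; last first.
  by rewrite (perm_size (perm i)) size_map size_bs.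
by apply/eqP; rewrite -subr_eq0 -mevalB -(fE _ _ kN) fy.
Qed.

(** The perturbation is taken in the form needed for the QQ-system: a multiple of the
    difference of the right-hand product and of a third one. *)
Theorem root_system_persists (delta : C) : 0 < delta ->
  exists2 eps : C, 0 < eps & forall tau : I -> C, (forall i, `|tau i| <= eps) ->
  exists x : V -> C, (forall v, `|x v| <= delta) /\
    forall i, root_eq i x + tau i *: (root_poly (bs i) x - root_poly (cs i) x) = 0.
Proof.
move=> delta0; have [U0 [k [U00 hU]]] := root_eqs_isolated.
pose U := (U0@_0%MM)^-1 *: U0.
have combo j : exists c : 'I_n -> P, \sum_l c l * F l = U * 'X_[xpow k j].
  have [c hc] := hU (nseq k j) (size_nseq _ _).
  exists (fun l => (U0@_0%MM)^-1 *: (c l * 'X_j)).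
  rewrite /U /xpow mulmSr mpolyXD -mpolyXn -scalerAl mulrA.
  have -> : 'X_j ^+ k = \prod_(j0 <- nseq k j) 'X_j0 :> P.
    by rewrite big_nseq -Monoid.iteropE.
  rewrite hc mulr_suml scaler_sumr; apply: eq_bigr => l _.
  by rewrite -scalerAl mulrAC.
have [h hh] := choice combo.
pose H : 'M[P]_n := \matrix_(j, l) h j l.
have F0 l : (F l)@_0%MM = 0.
  have -> (f : P) : f@_0%MM = f.@[at_point (fun=> 0)].
    rewrite {2}(mpolyE f) raddf_sum {1}(mpolyE f) raddf_sum; apply: eq_bigr => m _ /=.
    rewrite mcoeffZ mevalZ mcoeffX mevalX; congr (_ * _).
    case: eqVneq => [->|m0]; first by rewrite big1 // => j _; rewrite mnm0E expr0.
    have [j mj] : exists j, m j != 0%N.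
      apply/not_existsP => mj; case/eqP: m0; apply/mnmP => j; rewrite mnm0E.
      by apply/eqP/negPn/negP; apply: mj.
    by rewrite (bigD1 j) //= /at_point expr0n (negbTE mj) mul0r.
  by rewrite /F -coef_map meq_eval root_eq0 coef0.
pose mdiff i := root_prod (mbs i) - root_prod (mcs i).
pose GG (l : 'I_n) : P := let v := enum_val l in (mdiff (tag v))`_(tagged v).
have [|j|eps eps0 heps] := @zeros_persist R n k F H U GG F0 _ _ _ delta0.
- by rewrite mcoeffZ mulVf.
- by rewrite -hh; apply: eq_bigr => l _; rewrite mxE.
exists eps => // tau tau_small.
have [p [p_small pz]] := heps (fun l => tau (tag (enum_val l))) (fun l => tau_small _).
exists (fun v => p (enum_rank v)); split=> [v|i]; first exact: p_small.
set x := fun v => p (enum_rank v).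
have px : p = at_point x by apply/funext => j; rewrite /at_point /x enum_valK.
apply/polyP => m; rewrite coef0; have [mN|mN] := ltnP m (N i).
  have := pz (enum_rank (Tagged (fun i => 'I_(N i)) (Ordinal mN))).
  rewrite /GG /F enum_rankK /= mevalD mevalZ px -!coef_map meq_eval /mdiff rmorphB /=.
  by rewrite !meval_root_prod => e; rewrite coefD coefZ.
rewrite coefD coefZ !nth_default ?mulr0 ?addr0 //.
  apply: leq_trans (size_root_prod_sub _) _; by rewrite !size_map ?size_bs ?size_cs.
apply: leq_trans (size_root_prod_sub _) _; by rewrite !size_map ?size_as ?size_bs.
Qed.

End RootSystems.

From mathcomp Require Import all_classical all_reals all_analysis.
Import Order.TTheory GRing.Theory Num.Theory.
Import numFieldNormedType.Exports.
Local Open Scope classical_set_scope.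
Local Open Scope complex_scope.

(** * The Cartan matrix and the coordinates t_i *)

Lemma row_combination_eq0 (r : nat) (S : 'M[int]_r) (u : 'rV[int]_r) :
  \det S != 0 -> u *m S = 0 -> u = 0.
Proof.
move=> S0 uS; apply/rowP => i; rewrite mxE.
have : u *m S *m \adj S = 0 by rewrite uS mul0mx.
rewrite -mulmxA mul_mx_adj mul_mx_scalar => /rowP/(_ i).
by rewrite !mxE => /eqP; rewrite mulf_eq0 (negbTE S0) => /eqP.
Qed.

Section RootDatum.
Variables (r : nat) (D : based_root_datum r).

Lemma cartan_diag i : cartan_matrix D i i = 2.
Proof. by rewrite mxE pairing_coroot // simple_root_in. Qed.

(** In alpha_j - p alpha_i, a root, the coefficient of alpha_j is 1; hence the
    coefficient - p of alpha_i is nonnegative too. *)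
Lemma cartan_offdiag i j : i != j -> cartan_matrix D i j <= 0.
Proof.
move=> ij; rewrite mxE; set p := pairing _ _.
pose S := \matrix_(k < r) simple_root D k.
have comb (u : 'rV[int]_r) : u *m S = \sum_k u 0 k *: simple_root D k.
  by rewrite mulmx_sum_row; apply: eq_bigr => k _; rewrite rowK.
pose v : 'rV[int]_r := delta_mx 0 j - p *: delta_mx 0 i.
have vS : v *m S = simple_root D j - p *: simple_root D i.
  by rewrite mulmxBl -scalemxAl -!rowE !rowK.
have vj : v 0 j = 1 by rewrite !mxE !eqxx eq_sym (negbTE ij) mulr0 subr0.
have vi : v 0 i = - p by rewrite !mxE !eqxx (negbTE ij) mulr1 sub0r.
have := reflection_roots (simple_root_in D i) (simple_root_in D j).
case/simple_root_span => c hc.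
pose w : 'rV[int]_r := \row_k (c k)%:Z.
have wS : w *m S = \sum_k simple_root D k *+ c k.
  by rewrite comb; apply: eq_bigr => k _; rewrite mxE -scaler_nat natz.
have [h|h] : v = w \/ v = - w.
- case: hc => hc; [left|right]; apply/eqP; rewrite -subr_eq0; apply/eqP.
    apply: (@row_combination_eq0 _ S); first exact: simple_root_indep.
    by rewrite mulmxBl vS wS -hc subrr.
  apply: (@row_combination_eq0 _ S); first exact: simple_root_indep.
  by rewrite mulmxBl vS mulNmx wS -hc subrr.
- by rewrite -oppr_ge0 -vi h mxE.
- by have := vj; rewrite h !mxE => /eqP; rewrite eqr_oppLR.
Qed.

End RootDatum.

Section TorusCoordinates.
Variables (R : realType) (r : nat) (a : 'M[int]_r) (zeta : 'I_r -> R[i]).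
Hypothesis a_diag : forall i, a i i = 2.
Hypothesis zeta_neq0 : forall i, zeta i != 0.

Lemma tilde_xi_neq0 i : tilde_xi a zeta i != 0.
Proof.
rewrite mulf_neq0 // prodf_seq_neq0; apply/allP => j _.
by apply/implyP => _; apply: expfz_neq0.
Qed.

Lemma t_coord_neq0 i : t_coord a zeta i != 0.
Proof.
rewrite invr_eq0 prodf_seq_neq0; apply/allP => j _.
by apply/implyP => _; apply: expfz_neq0.
Qed.

Lemma xiE i : xi a zeta i = t_coord a zeta i * tilde_xi a zeta i.
Proof.
have split : hat_xi a zeta i =
    \prod_(j < r | (j < i)%N) zeta j ^ a j i *
    (zeta i ^ 2%:Z * \prod_(j < r | (i < j)%N) zeta j ^ a j i).
  rewrite /hat_xi (bigID (fun j : 'I_r => (j < i)%N)) /=; congr (_ * _).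
  rewrite (bigD1 i) /= ?ltnn // a_diag; congr (_ * _).
  apply: eq_bigl => j; rewrite -leqNgt [in RHS]ltn_neqAle andbC eq_sym.
  by rewrite -(inj_eq val_inj).
have p1 : \prod_(j < r | (j < i)%N) zeta j ^ a j i != 0.
  by apply/prodf_neq0 => j _; apply: expfz_neq0.
have p2 : \prod_(j < r | (i < j)%N) zeta j ^ a j i != 0.
  by apply/prodf_neq0 => j _; apply: expfz_neq0.
rewrite /t_coord split /xi /tilde_xi.
have -> : \prod_(j < r | (j < i)%N) zeta j ^ (- a j i) =
    (\prod_(j < r | (j < i)%N) zeta j ^ a j i)^-1.
  by rewrite -prodfV; apply: eq_bigr => j _; rewrite invr_expz.
rewrite -exprnP; move: p1 p2; set u := \prod_(_ < _ | _) _; set v := \prod_(_ < _ | _) _.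
by move=> u0 v0; have z0 := zeta_neq0 i; field; rewrite u0 v0 z0.
Qed.

End TorusCoordinates.

(** * The QQ-systems in root coordinates *)

Section QQRoots.
Variables (R : realType) (r : nat) (a : 'M[int]_r) (q : R[i]).
Local Notation C := R[i].
Variables (L Qp Qm : 'I_r -> {poly C}) (pr mr Lr : 'I_r -> seq C).
Hypothesis a_offdiag : forall i j, i != j -> a i j <= 0.
Hypothesis q_neq0 : q != 0.
Hypothesis L_roots : forall i, L i = \prod_(z <- Lr i) ('X - z%:P).
Hypothesis Qp_roots : forall i, Qp i = \prod_(z <- pr i) ('X - z%:P).
Hypothesis Qm_roots : forall i, Qm i = lead_coef (Qm i) *: \prod_(z <- mr i) ('X - z%:P).
Hypothesis Q_solution : infinite_QQ_system a q L Qp Qm.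

Definition root_count i := (size (pr i) + size (mr i))%N.
Local Notation V := {i : 'I_r & 'I_(root_count i)}.
Local Notation aff := (affine C V).

(** The roots of Q_+^i(qz) come first, those of Q_-^i(z) after them. *)
Definition root_center (v : V) : C := ([seq z / q | z <- pr (tag v)] ++ mr (tag v))`_(tagged v).
Definition root_coord (v : V) : aff := (root_center v, fun w => (w == v)%:R).
Definition scale_affine (k : C) (f : aff) : aff := (k * f.1, fun v => k * f.2 v).
Definition const_affine (c : C) : aff := (c, fun=> 0).

Definition index_p i (l : 'I_(size (pr i))) : V :=
  Tagged (fun i => 'I_(root_count i)) (lshift (size (mr i)) l).
Definition index_m i (l : 'I_(size (mr i))) : V :=
  Tagged (fun i => 'I_(root_count i)) (rshift (size (pr i)) l).

Definition shifted_roots i : seq aff := [seq root_coord (index_p l) | l <- fintype.enum 'I_(size (pr i))].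
Definition p_roots i : seq aff := map (scale_affine q) (shifted_roots i).
Definition m_roots i : seq aff := [seq root_coord (index_m l) | l <- fintype.enum 'I_(size (mr i))].
Definition lhs_roots i := shifted_roots i ++ m_roots i.
Definition rhs_roots i := map const_affine (Lr i) ++
  flatten [seq flatten (nseq `|a j i|%N (p_roots j)) | j <- fintype.enum 'I_r & j != i].
(** The roots of Q_+^i(z) Q_-^i(qz). *)
Definition twisted_roots i := p_roots i ++ map (scale_affine q^-1) (m_roots i).

Lemma root_coord_eval v (x : V -> C) : affine_eval (root_coord v) x = root_center v + x v.
Proof.
rewrite /affine_eval /= (bigD1 v) //= eqxx mul1r big1 ?addr0 // => w /negbTE->.
by rewrite mul0r.
Qed.

Lemma scale_eval k f (x : V -> C) : affine_eval (scale_affine k f) x = k * affine_eval f x.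
Proof.
rewrite /affine_eval /= mulrDr mulr_sumr; congr (_ + _).
by apply: eq_bigr => v _; rewrite mulrA.
Qed.

Lemma const_eval c (x : V -> C) : affine_eval (const_affine c) x = c.
Proof. by rewrite /affine_eval /= big1 ?addr0 // => v _; rewrite mul0r. Qed.

Lemma qshiftZ c (p : {poly C}) : qshift q (c *: p) = c *: qshift q p.
Proof. by rewrite /qshift comp_polyZ. Qed.

Lemma qshift_root_poly s x :
  qshift q (root_poly s x) = q ^+ size s *: root_poly (map (scale_affine q^-1) s) x.
Proof.
rewrite !root_polyE big_map; elim: s => [|f s IH].
  by rewrite !big_nil /qshift comp_polyC expr0 scale1r.
rewrite !big_cons exprS -scalerA [_ ^+ _ *: _]scalerAr -IH /qshift rmorphM scalerAl /=.
congr (_ * _); rewrite rmorphB /= comp_polyX comp_polyC scale_eval scalerBr.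
by rewrite -[q *: (_%:P)]mul_polyC -polyCM mulVKf.
Qed.

Definition QP x i := root_poly (p_roots i) x.
Definition QM x i := root_poly (m_roots i) x.

Lemma size_shifted_roots i : size (shifted_roots i) = size (pr i).
Proof. by rewrite size_map size_enum_ord. Qed.

Lemma size_p_roots i : size (p_roots i) = size (pr i).
Proof. by rewrite size_map size_shifted_roots. Qed.

Lemma size_m_roots i : size (m_roots i) = size (mr i).
Proof. by rewrite size_map size_enum_ord. Qed.

Lemma qshift_QP x i : qshift q (QP x i) = q ^+ size (pr i) *: root_poly (shifted_roots i) x.
Proof.
rewrite qshift_root_poly size_p_roots /p_roots !root_polyE !big_map; congr (_ *: _).
by apply: eq_bigr => l _; rewrite !scale_eval mulKf.
Qed.

Lemma lhs_rootsE x i :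
  root_poly (lhs_roots i) x = q ^- size (pr i) *: (qshift q (QP x i) * QM x i).
Proof.
rewrite qshift_QP root_poly_cat -scalerAl scalerA mulVf ?scale1r //.
by rewrite expf_neq0.
Qed.

Lemma twisted_rootsE x i :
  root_poly (twisted_roots i) x = q ^- size (mr i) *: (QP x i * qshift q (QM x i)).
Proof.
rewrite qshift_root_poly size_m_roots root_poly_cat -scalerAr scalerA mulVf ?scale1r //.
by rewrite expf_neq0.
Qed.

Lemma rhs_rootsE x i : root_poly (rhs_roots i) x = QQ_rhs a L (QP x) i.
Proof.
rewrite root_poly_cat /QQ_rhs L_roots; congr (_ * _).
  by rewrite root_polyE big_map; apply: eq_bigr => z _; rewrite const_eval.
rewrite root_poly_flatten big_map big_filter big_enum_cond; apply: eq_bigr => j ji.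
rewrite root_poly_flatten big_nseq -Monoid.iteropE.
by rewrite -[iterop _ _ _ _]/(QP x j ^+ _) exprnP -lez0_abs ?a_offdiag.
Qed.

Lemma QP0 i : QP (fun=> 0) i = Qp i.
Proof.
rewrite /QP root_polyE 2!big_map big_enum Qp_roots (big_nth 0) big_mkord.
apply: eq_bigr => l _; rewrite scale_eval root_coord_eval addr0 /root_center /=.
by rewrite nth_cat size_map ltn_ord (nth_map 0) // mulrCA mulfV ?mulr1.
Qed.

Lemma QM0_roots i : QM (fun=> 0) i = \prod_(z <- mr i) ('X - z%:P).
Proof.
rewrite /QM root_polyE big_map big_enum (big_nth 0) big_mkord.
apply: eq_bigr => l _; rewrite root_coord_eval addr0 /root_center /=.
by rewrite nth_cat size_map ltnNge leq_addr /= addKn.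
Qed.

Lemma QQ_rhs_monic x i : QQ_rhs a L (QP x) i \is monic.
Proof. by rewrite -rhs_rootsE root_poly_monic. Qed.

(** Both sides of the infinite system are compared in top degree. *)
Lemma lead_Qm i : lead_coef (Qm i) = q ^- size (pr i).
Proof.
have [_ /(_ i)] := Q_solution.
have -> : QQ_rhs a L Qp i = QQ_rhs a L (QP (fun=> 0)) i.
  by rewrite /QQ_rhs; under eq_bigr do rewrite -QP0.
rewrite -QP0 Qm_roots -QM0_roots => h.
(* the right-hand side is monic, so the leading coefficients on the left multiply to 1 *)
have := QQ_rhs_monic (fun=> 0) i; rewrite -h qshift_QP monicE.
rewrite !lead_coefM !lead_coefZ !(monicP (root_poly_monic _ _)) !mulr1 => /eqP e.
by rewrite -[LHS]mul1r -(mulVf (expf_neq0 (size (pr i)) q_neq0)) -mulrA e mulr1.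
Qed.

Lemma QM0 i : Qm i = q ^- size (pr i) *: QM (fun=> 0) i.
Proof. by rewrite QM0_roots -lead_Qm. Qed.

Lemma lhs_eq_rhs0 i : root_eq lhs_roots rhs_roots i (fun=> 0) = 0.
Proof.
have [_ /(_ i) h] := Q_solution; rewrite /root_eq lhs_rootsE rhs_rootsE QP0.
rewrite scalerAr -QM0 h /QQ_rhs.
by under [X in _ * X - _]eq_bigr do rewrite -QP0; rewrite subrr.
Qed.

Lemma size_lhs i : size (lhs_roots i) = root_count i.
Proof. by rewrite size_cat size_shifted_roots size_m_roots. Qed.

Lemma size_rhs i : size (rhs_roots i) = root_count i.
Proof.
apply/eqP; rewrite -eqSS -(size_root_poly _ (fun=> 0)) -size_lhs.
have /eqP := lhs_eq_rhs0 i; rewrite /root_eq subr_eq0 => /eqP <-.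
by rewrite size_root_poly.
Qed.

Lemma size_twisted i : size (twisted_roots i) = root_count i.
Proof. by rewrite size_cat size_p_roots size_map size_m_roots. Qed.

Lemma roots_infinite_QQ x : (forall i, root_eq lhs_roots rhs_roots i x = 0) ->
  infinite_QQ_system a q L (QP x) (fun i => q ^- size (pr i) *: QM x i).
Proof.
move=> h; split=> i; first exact: root_poly_monic.
rewrite -scalerAr -lhs_rootsE -rhs_rootsE; apply/eqP.
by rewrite -subr_eq0; apply/eqP/h.
Qed.

Lemma same_degrees_roots x (c : 'I_r -> C) : (forall i, c i != 0) ->
  same_degrees (QP x) (fun i => c i *: QM x i) Qp Qm.
Proof.
move=> c0 i; rewrite QM0 -QP0 !size_scale ?size_root_poly //.
by rewrite invr_eq0 expf_neq0.
Qed.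

(** With A = Q_+(qz) Q_-(z), B = Q_+(z) Q_-(qz) for the monic polynomials with the
    given roots and d, e their degrees, the hypothesis is
    q^-d A - W + tau (W - q^-e B) = 0, that is A - t B = q^d (1 - tau) W, since
    tau q^-e = t q^-d. *)
Lemma roots_QQ zeta x (tau : 'I_r -> C) :
  (forall i, a i i = 2) -> (forall i, zeta i != 0) ->
  (forall i, tau i = t_coord a zeta i * (q ^+ size (mr i) / q ^+ size (pr i))) ->
  (forall i, 1 - tau i != 0) ->
  (forall i, root_eq lhs_roots rhs_roots i x +
     tau i *: (root_poly (rhs_roots i) x - root_poly (twisted_roots i) x) = 0) ->
  QQ_system a q L zeta (QP x)
    (fun i => (tilde_xi a zeta i)^-1 *: ((q ^- size (pr i) / (1 - tau i)) *: QM x i)).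
Proof.
move=> a2 z0 tauE tau1 h; split=> i; first exact: root_poly_monic.
have txi := tilde_xi_neq0 a z0 i.
set c := q ^- _ / _; set T := tilde_xi _ _ _.
have E1 (v : {poly C}) : T *: (T^-1 *: (c *: v)) = c *: v.
  by rewrite !scalerA mulVKf.
have E2 (v : {poly C}) : xi a zeta i *: (T^-1 *: (c *: v)) = (t_coord a zeta i * c) *: v.
  by rewrite xiE // !scalerA -[_ * T * _]mulrA mulVKf.
rewrite !qshiftZ -!scalerAr E1 E2 /c.
have := h i; rewrite /root_eq lhs_rootsE twisted_rootsE rhs_rootsE.
set A := qshift q (QP x i) * _; set B := QP x i * _; set W := QQ_rhs _ _ _ _.
have d0 : q ^+ size (pr i) != 0 by rewrite expf_neq0.
have e0 : q ^+ size (mr i) != 0 by rewrite expf_neq0.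
move=> e.
have e' : (1 - tau i) *: W = q ^- size (pr i) *: A - (tau i * q ^- size (mr i)) *: B.
  apply/eqP; rewrite -subr_eq0 -oppr_eq0; apply/eqP; rewrite -[RHS]e.
  rewrite scalerBl scale1r scalerBr scalerA; move: (_ *: A) (_ *: B) (_ *: W) => X Y Z; ring.
have -> : W = (1 - tau i)^-1 *: ((1 - tau i) *: W) by rewrite scalerA mulVf ?scale1r.
rewrite e' scalerBr !scalerA; congr (_ *: _ - _ *: _); first by rewrite mulrC.
have -> : tau i * q ^- size (mr i) = t_coord a zeta i * q ^- size (pr i).
  by rewrite tauE; field; rewrite d0 e0.
by rewrite mulrA mulrC.
Qed.

End QQRoots.

(** * Continuity at the center *)

Section SmallPerturbations.
Variables (R : realType) (V : finType).
Local Notation C := R[i].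
Implicit Types (f g : (V -> C) -> C).

(** Continuity at the origin of C^V. *)
Definition continuous0 f := forall eta : C, 0 < eta -> exists2 delta : C, 0 < delta &
  forall x, (forall v, `|x v| <= delta) -> `|f x - f (fun=> 0)| <= eta.

Lemma positive_lower_bound (b c : C) : 0 < b -> 0 < c ->
  exists2 d : C, 0 < d & d <= b /\ d <= c.
Proof.
move=> b0 c0; exists (b * c / (b + c)).
  by rewrite divr_gt0 ?mulr_gt0 ?addr_gt0.
rewrite !ler_pdivrMr ?addr_gt0 // !mulrDr; split.
  by rewrite lerDr mulr_ge0 // ltW.
by rewrite mulrC lerDl mulr_ge0 // ltW.
Qed.

Lemma continuous0_ext f g : f =1 g -> continuous0 f -> continuous0 g.
Proof. by move=> /funext->. Qed.

Lemma continuous0_cst (c : C) : continuous0 (fun=> c).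
Proof. by move=> eta eta0; exists 1 => // x _; rewrite subrr normr0 ltW. Qed.

Lemma continuous0_coord v : continuous0 (fun x => x v).
Proof. by move=> eta eta0; exists eta => // x; rewrite subr0. Qed.

Lemma continuous0D f g : continuous0 f -> continuous0 g -> continuous0 (fun x => f x + g x).
Proof.
move=> cf cg eta eta0.
have [|b b0 hb] := cf (eta / 2); first by rewrite divr_gt0.
have [|c c0 hc] := cg (eta / 2); first by rewrite divr_gt0.
have [d d0 [db dc]] := positive_lower_bound b0 c0; exists d => // x hx.
rewrite opprD addrACA (splitr eta); apply: le_trans (ler_normD _ _) _.
by rewrite lerD ?hb ?hc // => v; apply: le_trans (hx v) _.
Qed.

Lemma continuous0M f g : continuous0 f -> continuous0 g -> continuous0 (fun x => f x * g x).
Proof.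
move=> cf cg eta eta0; set f0 := f (fun=> 0); set g0 := g (fun=> 0).
pose B := `|f0| + `|g0| + 1; have B0 : 0 < B by rewrite ltr_wpDl ?addr_ge0.
pose k := eta / (2 * B); have k0 : 0 < k by rewrite divr_gt0 ?mulr_gt0.
have [b b0 hb] := cf _ k0; have [c c0 hc] := cg _ k0.
have [e e0 he] := cg _ ltr01.
have [d1 d10 [d1b d1c]] := positive_lower_bound b0 c0.
have [d d0 [dd1 de]] := positive_lower_bound d10 e0; exists d => // x hx.
have hf : `|f x - f0| <= k by apply: hb => v; rewrite (le_trans (hx v)) ?(le_trans dd1).
have hg : `|g x - g0| <= k by apply: hc => v; rewrite (le_trans (hx v)) ?(le_trans dd1).
have hg1 : `|g x - g0| <= 1 by apply: he => v; rewrite (le_trans (hx v)).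
have gB : `|g x| <= B.
  rewrite -[g x](subrK g0); apply: le_trans (ler_normD _ _) _.
  by rewrite /B addrC -addrA ler_wpDl // lerD.
have -> : f x * g x - f0 * g0 = (f x - f0) * g x + f0 * (g x - g0) by ring.
apply: le_trans (ler_normD _ _) _; rewrite !normrM.
have -> : eta = k * B + B * k by rewrite /k; field; rewrite gt_eqF.
rewrite lerD // ler_pM //.
by rewrite /B -addrA lerDl addr_ge0.
Qed.

Lemma continuous0_sum (I : Type) (s : seq I) (F : I -> (V -> C) -> C) :
  (forall i, continuous0 (F i)) -> continuous0 (fun x => \sum_(i <- s) F i x).
Proof.
move=> h; elim: s => [|i s IH].
  by apply: continuous0_ext (continuous0_cst 0) => x; rewrite big_nil.
by apply: continuous0_ext (continuous0D (h i) IH) => x; rewrite big_cons.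
Qed.

Lemma continuous0_affine (f : affine C V) : continuous0 (affine_eval f).
Proof.
apply: continuous0D; first exact: continuous0_cst.
apply: continuous0_sum => v; apply: continuous0M; first exact: continuous0_cst.
exact: continuous0_coord.
Qed.

Lemma continuous0_root_poly (s : seq (affine C V)) k :
  continuous0 (fun x => (root_poly s x)`_k).
Proof.
elim: s k => [|f s IH] k.
  by apply: continuous0_ext (continuous0_cst (1 : {poly C})`_k) => x; rewrite root_polyE big_nil.
have cf := continuous0M (continuous0_cst (-1)) (continuous0M (continuous0_affine f) (IH k)).
have cs : continuous0 (fun x => if k is l.+1 then (root_poly s x)`_l else 0).
  by case: k {cf} => [|l]; [exact: continuous0_cst|exact: IH].
apply: continuous0_ext (continuous0D cs cf) => x.
rewrite [RHS](_ : _ = (('X - (affine_eval f x)%:P) * root_poly s x)`_k); last first.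
  by rewrite !root_polyE big_cons.
by rewrite mulrBl coefB coefXM coefCM mulN1r; case: k {cf cs}.
Qed.

Lemma continuous0_family (I : finType) (F : I -> (V -> C) -> C) :
  (forall i, continuous0 (F i)) -> forall eta : C, 0 < eta -> exists2 delta : C, 0 < delta &
  forall x, (forall v, `|x v| <= delta) -> forall i, `|F i x - F i (fun=> 0)| <= eta.
Proof.
move=> cF eta eta0.
have gen (s : seq I) : exists2 delta : C, 0 < delta & forall x,
    (forall v, `|x v| <= delta) -> forall i, i \in s -> `|F i x - F i (fun=> 0)| <= eta.
  elim: s => [|i s [d d0 hd]]; first by exists 1.
  have [c c0 hc] := cF i _ eta0; have [e e0 [ed ec]] := positive_lower_bound d0 c0.
  exists e => // x hx j; rewrite inE => /predU1P[->|js].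
    by apply: hc => v; apply: le_trans (hx v) _.
  by apply: hd js => v; apply: le_trans (hx v) _.
have [d d0 hd] := gen (index_enum I); exists d => // x hx i.
by apply: hd => //; rewrite mem_index_enum.
Qed.

End SmallPerturbations.

Lemma positive_complex (R : realType) (c : R[i]) : 0 < c -> exists2 e : R, 0 < e & c = e%:C.
Proof.
move=> c0; exists (complex.Re c); last by rewrite RRe_real // gtr0_real.
by rewrite -ltcR RRe_real // gtr0_real.
Qed.

(** Solutions chosen for each z separately can be made to tend to 0: let eps_m be small
    enough for solutions of size 2^-m, and for z use the largest m with z smaller than
    eps_m.  If there is no largest m, then z is smaller than any positive number. *)
Lemma choose_small_solution (R : realType) (T : Type) (V : finType)
    (size_of : T -> R[i] -> Prop) (S : T -> (V -> R[i]) -> Prop) :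
  (forall z (e e' : R[i]), e <= e' -> size_of z e -> size_of z e') ->
  (forall delta : R[i], 0 < delta -> exists2 eps : R[i], 0 < eps &
     forall z, size_of z eps -> exists x, (forall v, `|x v| <= delta) /\ S z x) ->
  (forall z, (forall eps : R[i], 0 < eps -> size_of z eps) -> S z (fun=> 0)) ->
  exists X : T -> V -> R[i],
    (exists2 eps : R[i], 0 < eps & forall z, size_of z eps -> S z (X z)) /\
    forall delta : R[i], 0 < delta -> exists2 eps : R[i], 0 < eps &
      forall z, size_of z eps -> forall v, `|X z v| <= delta.
Proof.
move=> mono sol sol0.
have halves (m : nat) : 0 < (2 : R[i]) ^- m by rewrite invr_gt0 exprn_gt0.
have small (e : R[i]) : 0 < e -> exists m, (2 : R[i]) ^- m <= e.
  move=> e0; apply/not_existsP => h.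
  have : e = 0.
    apply: (@le_geometric_eq0 _ _ 1) => m; rewrite mul1r ger0_norm ?ltW //.
    have := h m; rewrite real_leNgt ?gtr0_real // => /negP; rewrite negbK => /ltW //.
  by move=> e00; rewrite e00 ltxx in e0.
have {}sol m : exists eps : R[i], [/\ 0 < eps, eps <= 2 ^- m & forall z, size_of z eps ->
    exists x, (forall v, `|x v| <= 2 ^- m) /\ S z x].
  have [e e0 he] := sol _ (halves m).
  have [d d0 [de dm]] := positive_lower_bound e0 (halves m).
  by exists d; split=> // z /(mono _ _ _ de)/he.
have [eps heps] := choice sol.
have pick z : exists x : V -> R[i], forall m, size_of z (eps m) ->
    S z x /\ forall v, `|x v| <= 2 ^- m.
  have [unb|/existsNP[M hM]] := pselect (forall M, exists2 m, (M <= m)%N & size_of z (eps m)).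
    exists (fun=> 0) => m1 _; split=> [|v]; last by rewrite normr0 ltW.
    apply: sol0 => e /small[M hM]; have [m Mm hMm] := unb M.
    have [_ em _] := heps m; apply: mono hMm; apply: le_trans em _; apply: le_trans hM.
    by rewrite ler_pV2 ?inE ?unitfE ?expf_neq0 ?exprn_gt0 // ler_eXn2l ?ltr1n.
  have {}hM m : size_of z (eps m) -> (m <= M)%N.
    by move=> hm; rewrite leqNgt; apply/negP => /ltnW Mm; apply: hM; exists m.
  have [[m0 hm0]|none] := pselect (exists m, size_of z (eps m)); last first.
    by exists (fun=> 0) => m hm; case: none; exists m.
  have exm : exists m, `[< size_of z (eps m) >] by exists m0; apply/asboolP.
  have bnd m : `[< size_of z (eps m) >] -> (m <= M)%N by move/asboolP/hM.
  case: (ex_maxnP exm bnd) => m /asboolP hm mmax.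
  have [_ _ /(_ z hm)[x [xs Sx]]] := heps m; exists x => l /asboolP/mmax lm.
  split=> // v; apply: le_trans (xs v) _.
  by rewrite ler_pV2 ?inE ?unitfE ?expf_neq0 ?exprn_gt0 // ler_eXn2l ?ltr1n.
have [X hX] := choice pick; exists X; split.
  by exists (eps 0%N) => [|z /hX[]//]; case: (heps 0%N).
move=> delta /small[m hm]; exists (eps m) => [|z /hX[_ h] v]; first by case: (heps m).
exact: le_trans (h v) hm.
Qed.

(** * Isolated solutions lie on no line of solutions *)

Section IsolatedRoots.
Variables (R : realType) (r : nat) (a : 'M[int]_r) (q : R[i]).
Local Notation C := R[i].
Variables (L Qp Qm : 'I_r -> {poly C}) (pr mr Lr : 'I_r -> seq C).
Hypothesis a_offdiag : forall i j, i != j -> a i j <= 0.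
Hypothesis q_neq0 : q != 0.
Hypothesis L_roots : forall i, L i = \prod_(z <- Lr i) ('X - z%:P).
Hypothesis Qp_roots : forall i, Qp i = \prod_(z <- pr i) ('X - z%:P).
Hypothesis Qm_roots : forall i, Qm i = lead_coef (Qm i) *: \prod_(z <- mr i) ('X - z%:P).
Hypothesis Q_isolated : isolated_infinite_solution a q L Qp Qm.

Local Notation V := {i : 'I_r & 'I_(root_count pr mr i)}.
Local Notation ctr := (@root_center R r q pr mr).
Local Notation lhs := (@lhs_roots R r q pr mr).
Local Notation rhs := (rhs_roots a q pr mr Lr).
Local Notation QP := (@QP R r q pr mr).
Local Notation QM := (@QM R r q pr mr).
Let Q_solution : infinite_QQ_system a q L Qp Qm := proj1 Q_isolated.
Let QP_center := QP0 mr q_neq0 Qp_roots.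
Let QM_center := QM0 a_offdiag q_neq0 L_roots Qp_roots Qm_roots Q_solution.

Lemma root_lhs (v : V) x :
  (root_poly (lhs (tag v)) x).[ctr v + x v] = 0.
Proof.
case: v => i l; rewrite root_poly_cat hornerM.
case: (split_ordP l) => l' ->.
  rewrite -[_ + _]root_coord_eval -/(index_p mr l').
  by rewrite (root_poly_root (fun l => root_coord q (index_p mr l))) mul0r.
rewrite -[_ + _]root_coord_eval -/(index_m pr l').
by rewrite [X in _ * X](root_poly_root (fun l => root_coord q (index_m pr l))) mulr0.
Qed.

(** Small displacements of the roots that solve the system give solutions with nearby
    coefficients; by isolation these are the given ones. *)
Lemma solutions_near_center : exists2 delta : C, 0 < delta &
  forall x : V -> C, (forall v, `|x v| <= delta) ->
  (forall i, root_eq lhs rhs i x = 0) ->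
  forall i, root_poly (lhs i) x = root_poly (lhs i) (fun=> 0).
Proof.
case: Q_isolated => _ [_ [W /nbhs_ballP[eta /= eta0 sub] WA]].
set n := (\max_(i < r) _)%N in sub WA.
pose F (b : bool * ('I_r * 'I_n)) (x : V -> C) : C :=
  if b.1 then (QP x b.2.1)`_b.2.2 else q ^- size (pr b.2.1) * (QM x b.2.1)`_b.2.2.
have cF b : continuous0 (F b).
  case: b => [[] [i k]] /=; first exact: continuous0_root_poly.
  by apply: continuous0M; [exact: continuous0_cst|exact: continuous0_root_poly].
have [|delta delta0 hdelta] := continuous0_family cF (eta := eta / 2).
  by rewrite divr_gt0.
exists delta => // x x_small hx.
pose Mx i := q ^- size (pr i) *: QM x i.
have deg : same_degrees (QP x) Mx Qp Qm.
  apply: (same_degrees_roots a_offdiag q_neq0 L_roots Qp_roots Qm_roots Q_solution) => i.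
  by rewrite invr_eq0 expf_neq0.
have half : eta / 2 < eta by rewrite ltr_pdivrMr // ltr_pMr // ltr1n.
have : (W `&` [set c | exists Pp Pm, infinite_QQ_system a q L Pp Pm /\
          same_degrees Pp Pm Qp Qm /\ c = coefs n Pp Pm]) (coefs n (QP x) Mx).
  split; last first.
    exists (QP x), Mx; split=> //; first exact: (roots_infinite_QQ a_offdiag q_neq0 L_roots).
  apply: sub; split; split => //= i k; rewrite !mxE -ball_normE /ball_ /= distrC.
    have := hdelta x x_small (true, (i, k)); rewrite /F /= QP_center.
    by move/le_lt_trans; apply.
  rewrite QM_center !coefZ.
  have := hdelta x x_small (false, (i, k)); rewrite /F /=.
  by move/le_lt_trans; apply.
rewrite WA => -[/matrixP eP /matrixP eM] i.
have le_n : (maxn (size (Qp i)) (size (Qm i)) <= n)%N by exact: leq_bigmax.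
have [dP dM] := deg i.
have eQP : QP x i = QP (fun=> 0) i.
  rewrite QP_center; apply/polyP => k; have [kn|nk] := ltnP k n.
    by have := eP i (Ordinal kn); rewrite !mxE.
  rewrite !nth_default ?dP //; apply: leq_trans nk; apply: leq_trans le_n; exact: leq_maxl.
have eQM : QM x i = QM (fun=> 0) i.
  have qd : q ^- size (pr i) != 0 by rewrite invr_eq0 expf_neq0.
  apply: (scalerI qd); rewrite -QM_center -/(Mx i).
  apply/polyP => k; have [kn|nk] := ltnP k n.
    by have := eM i (Ordinal kn); rewrite !mxE.
  rewrite !nth_default ?dM //; apply: leq_trans nk; apply: leq_trans le_n; exact: leq_maxr.
by rewrite (lhs_rootsE q_neq0) eQP eQM -(lhs_rootsE q_neq0).
Qed.

(** Along a line of solutions the roots would move while the polynomials, by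
    solutions_near_center, stay the same near the center: the polynomial of all the roots would
    have infinitely many roots. *)
Lemma no_solution_line (y : V -> C) : (exists v, y v != 0) ->
  ~ forall (t : C) i, root_eq lhs rhs i (fun v => t * y v) = 0.
Proof.
move=> [v yv] line; have [delta delta0 hdelta] := solutions_near_center.
pose Y := 1 + \sum_v `|y v|.
have Y0 : 0 < Y by rewrite ltr_wpDr ?ltr01 ?sumr_ge0.
pose p := root_poly (lhs (tag v)) (fun=> 0).
have small t : `|t| <= delta / Y -> root p (ctr v + t * y v).
  move=> ht; rewrite /p -(hdelta (fun v => t * y v)) // => [|w].
    by rewrite /root (root_lhs v (fun v => t * y v)).
  rewrite normrM; apply: le_trans (_ : (delta / Y) * Y <= _); last by rewrite divfK // gt_eqF.
  rewrite ler_pM // /Y (bigD1 w) //= addrCA lerDl addr_ge0 ?sumr_ge0 //.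
(* displacements within the radius of isolation, along the line *)
pose s := [seq ctr v + (delta / Y / (m.+1)%:R) * y v | m <- iota 0 (size p)].
have : (size s < size p)%N.
  apply: max_poly_roots; first exact/monic_neq0/root_poly_monic.
    apply/allP => _ /mapP[m _ ->]; apply: small.
    have dY : 0 <= delta / Y by rewrite divr_ge0 ?ltW.
    by rewrite normrM normfV normr_nat (ger0_norm dY) ler_piMr // invf_le1 ?ler1n ?ltr0n.
  rewrite map_inj_uniq ?iota_uniq // => m m' /addrI/(mulIf yv)/mulfI.
  move=> /(_ _)/invr_inj/eqP; rewrite eqr_nat => h.
  by apply/eqP; rewrite -eqSS h // mulf_neq0 ?invr_eq0 ?gt_eqF.
by rewrite size_map size_iota ltnn.
Qed.

End IsolatedRoots.

(** * Lifting isolated solutions *)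

Section Lifts.
Variables (R : realType) (r : nat) (a : 'M[int]_r) (q : R[i]).
Local Notation C := R[i].

Lemma cvg_t_to_0 (f : ('I_r -> C) -> C) (l : C) :
  (forall eta : C, 0 < eta -> exists2 e : C, 0 < e & forall zeta,
     generic_torus a q zeta -> (forall i, `|t_coord a zeta i| < e) -> `|f zeta - l| <= eta) ->
  (f : _ -> C^o) @ t_to_0 a q --> (l : C^o).
Proof.
move=> h W /nbhs_ballP[eta /= eta0 sub].
have [|e /positive_complex[e1 e10 ->] he] := h (eta / 2); first by rewrite divr_gt0.
exists e1 => //= zeta [gen small]; apply: sub; rewrite -ball_normE /ball_ /= distrC.
by apply: le_lt_trans (he _ gen small) _; rewrite ltr_pdivrMr // ltr_pMr // ltr1n.
Qed.

End Lifts.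

Theorem theorem4p5 (R : realType) (r : nat) (D : based_root_datum r)
    (D_simple : simple_datum D) (D_sc : simply_connected_datum D)
    (q : R[i]) (q_neq0 : q != 0)
    (L : 'I_r -> {poly R[i]}) (L_monic : forall i, L i \is monic)
    (Qp Qm : 'I_r -> {poly R[i]})
    (Q_isolated : isolated_infinite_solution (cartan_matrix D) q L Qp Qm) :
  exists (e : R) (QpZ QmZ : ('I_r -> R[i]) -> 'I_r -> {poly R[i]}),
    0 < e /\
    lifts (cartan_matrix D) q e QpZ QmZ Qp Qm /\
    (forall zeta : 'I_r -> R[i],
       generic_torus (cartan_matrix D) q zeta ->
       (forall i, `|t_coord (cartan_matrix D) zeta i| < e%:C) ->
       QQ_system (cartan_matrix D) q L zeta (QpZ zeta) (QmZ zeta)).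
Proof.
set a := cartan_matrix D in Q_isolated *.
have a_offdiag i j : i != j -> a i j <= 0 by apply: cartan_offdiag.
have Q_solution : infinite_QQ_system a q L Qp Qm := proj1 Q_isolated.
have roots_of (p : 'I_r -> {poly R[i]}) : exists s : 'I_r -> seq R[i],
    forall i, p i = lead_coef (p i) *: \prod_(z <- s i) ('X - z%:P).
  exists (fun i => sval (closed_field_poly_normal (p i))) => i.
  exact: (svalP (closed_field_poly_normal (p i))).
have [Lr L_lead] := roots_of L; have [pr Qp_lead] := roots_of Qp.
have [mr Qm_roots] := roots_of Qm.
have L_roots i : L i = \prod_(z <- Lr i) ('X - z%:P).
  by rewrite L_lead (monicP (L_monic i)) scale1r.
have Qp_roots i : Qp i = \prod_(z <- pr i) ('X - z%:P).
  by rewrite Qp_lead (monicP (proj1 Q_solution i)) scale1r.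
pose k i : R[i] := q ^+ size (mr i) / q ^+ size (pr i).
pose tau zeta i := t_coord a zeta i * k i.
(* |tau| <= 1/2 keeps the leading coefficient 1 - tau away from 0 *)
pose S zeta x := (forall i, root_eq (lhs_roots q pr mr) (rhs_roots a q pr mr Lr) i x +
    tau zeta i *: (root_poly (rhs_roots a q pr mr Lr i) x -
                   root_poly (twisted_roots q pr mr i) x) = 0) /\
  forall i, `|tau zeta i| <= 2^-1.
pose small zeta (e : R[i]) := generic_torus a q zeta /\ forall i, `|t_coord a zeta i| < e.
pose B := 1 + \sum_i `|k i|.
have B0 : 0 < B by rewrite ltr_wpDr ?ltr01 ?sumr_ge0.
have tau_small zeta (e : R[i]) : 0 < e -> small zeta (e / B) -> forall i, `|tau zeta i| <= e.
  move=> e0 [_ ts] i; rewrite normrM; apply: le_trans (_ : (e / B) * B <= _).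
    by rewrite ler_pM ?(ltW (ts i)) // /B (bigD1 i) //= addrCA lerDl addr_ge0 ?sumr_ge0.
  by rewrite divfK // gt_eqF.
have persists := root_system_persists (size_lhs q pr mr)
  (size_rhs a_offdiag q_neq0 L_roots Qp_roots Qm_roots Q_solution)
  (size_twisted q pr mr)
  (lhs_eq_rhs0 a_offdiag q_neq0 L_roots Qp_roots Qm_roots Q_solution)
  (no_solution_line a_offdiag q_neq0 L_roots Qp_roots Qm_roots Q_isolated).
have small_mono z (e1 e2 : R[i]) : e1 <= e2 -> small z e1 -> small z e2.
  by move=> le12 [gen h]; split=> // i; apply: lt_le_trans (h i) le12.
have solve delta : 0 < delta -> exists2 eps : R[i], 0 < eps &
    forall z, small z eps -> exists x, (forall v, `|x v| <= delta) /\ S z x.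
  move=> delta0; have [eps eps0 heps] := persists _ delta0.
  have half0 : 0 < 2^-1 :> R[i] by rewrite invr_gt0.
  have [d d0 [de d2]] := positive_lower_bound eps0 half0.
  exists (d / B) => [|zeta zs]; first by rewrite divr_gt0.
  have ts := tau_small zeta d d0 zs.
  have [x [xs xe]] := heps (tau zeta) (fun i => le_trans (ts i) de).
  by exists x; split=> //; split=> // i; apply: le_trans (ts i) d2.
(* t_i never vanishes, so a zeta that is small at every scale forces r = 0 *)
have solve0 zeta : (forall eps : R[i], 0 < eps -> small zeta eps) -> S zeta (fun=> 0).
  move=> zs; have [[z0 _] _] := zs 1 ltr01.
  have no (i : 'I_r) : False.
    have t0 : 0 < `|t_coord a zeta i| by rewrite normr_gt0 t_coord_neq0.
    by have [_ /(_ i)] := zs _ t0; rewrite ltxx.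
  by split=> i; case: (no i).
have [X [[eps /positive_complex[e e0 ->] solX] smallX]] :=
  choose_small_solution small_mono solve solve0.
have tau1 zeta : small zeta e%:C -> forall i, 1 - tau zeta i != 0.
  move=> /solX[_ h] i; rewrite subr_eq0; apply: contraTneq (h i) => <-.
  have half1 : 2^-1 < 1 :> R[i] by rewrite invf_lt1 ?ltr0n // ltr1n.
  by rewrite normr1; apply/negP => /le_lt_trans/(_ half1); rewrite ltxx.
pose Qpz zeta := QP q (pr := pr) (mr := mr) (X zeta).
pose c zeta i := q ^- size (pr i) / (1 - tau zeta i).
pose Qmz zeta i := (tilde_xi a zeta i)^-1 *: (c zeta i *: QM q (pr := pr) (mr := mr) (X zeta) i).
exists e, Qpz, Qmz; split=> //; split; last first.
  move=> zeta gen ts; have zs : small zeta e%:C by [].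
  have [Sx _] := solX _ zs; apply: roots_QQ => //.
  - by move=> i; apply: cartan_diag.
  - by case: gen.
  - exact: tau1.
have c_neq0 zeta i : small zeta e%:C -> c zeta i != 0.
  by move=> zs; rewrite mulf_neq0 ?invr_eq0 ?expf_neq0 ?tau1.
split.
  move=> zeta [gen ts]; have zs : small zeta e%:C by [].
  have -> : Qmz zeta = fun i => ((tilde_xi a zeta i)^-1 * c zeta i) *:
      QM q (pr := pr) (mr := mr) (X zeta) i.
    by apply/funext => i; rewrite /Qmz scalerA.
  apply: (same_degrees_roots a_offdiag q_neq0 L_roots Qp_roots Qm_roots Q_solution) => i.
  by rewrite mulf_neq0 ?c_neq0 // invr_eq0 tilde_xi_neq0 //; case: gen.
have cvgX (f : ({i : 'I_r & 'I_(root_count pr mr i)} -> R[i]) -> R[i]) : continuous0 f ->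
    ((fun zeta => f (X zeta)) : _ -> R[i]^o) @ t_to_0 a q --> (f (fun=> 0) : R[i]^o).
  move=> cf; apply: cvg_t_to_0 => eta eta0.
  have [d d0 hd] := cf _ eta0; have [e1 e10 he1] := smallX _ d0.
  by exists e1 => // zeta gen ts; apply: hd; apply: he1.
move=> i n; split.
  rewrite -(QP0 mr q_neq0 Qp_roots); apply: (cvgX (fun x => (QP q (pr:=pr) (mr:=mr) x i)`_n)).
  exact: continuous0_root_poly.
rewrite (QM0 a_offdiag q_neq0 L_roots Qp_roots Qm_roots Q_solution) coefZ.
apply: cvg_t_to_0 => eta eta0.
set d := q ^- size (pr i); set m0 := (QM q _ i)`_n.
have d0 : 0 < `|d| by rewrite normr_gt0 invr_eq0 expf_neq0.
pose eta1 := eta / (2 * `|d| * (1 + `|m0|)).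
have m1 : 0 < 1 + `|m0| by rewrite ltr_wpDr.
have eta10 : 0 < eta1 by rewrite divr_gt0 // !mulr_gt0.
have cQM : continuous0 (fun x => (QM q (pr := pr) (mr := mr) x i)`_n).
  exact: continuous0_root_poly.
have [d1 d10 hd1] := cQM _ eta10; have [e1 e10 he1] := smallX _ d10.
have eB : 0 < eta1 / B by rewrite divr_gt0.
have [e2 e20 [e21 e2B]] := positive_lower_bound e10 eB.
have eC : 0 < e%:C :> R[i] by rewrite ltcR.
have [e3 e30 [e32 e3e]] := positive_lower_bound e20 eC.
exists e3 => // zeta gen ts; have zs3 : small zeta e3 by [].
have zs := small_mono _ _ _ e3e zs3.
have zs2 := small_mono _ _ _ e32 zs3.
have hQM := hd1 _ (he1 _ (small_mono _ _ _ e21 zs2)).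
have htau := tau_small _ _ eta10 (small_mono _ _ _ e2B zs2) i.
have [_ /(_ i) tau_half] := solX _ zs; have t1 := tau1 _ zs i.
have txi : tilde_xi a zeta i != 0 by apply: tilde_xi_neq0; case: gen.
have -> : (tilde_xi a zeta i *: Qmz zeta i)`_n =
    c zeta i * (QM q (pr := pr) (mr := mr) (X zeta) i)`_n.
  by rewrite /Qmz !scalerA mulVKf // coefZ.
move: hQM; rewrite -/m0; set m := (QM q (X zeta) i)`_n => hQM.
(* c - d = c tau *)
have -> : c zeta i * m - d * m0 = c zeta i * ((m - m0) + tau zeta i * m0).
  by rewrite /c -/d; field.
have c_bound : `|c zeta i| <= 2 * `|d|.
  rewrite /c -/d normrM [X in _ * X]normfV ler_pdivrMr ?normr_gt0 // mulrAC -[X in X <= _]mul1r.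
  rewrite ler_wpM2r //; have : 1 - `|tau zeta i| <= `|1 - tau zeta i|.
    by rewrite -[X in X - _](normr1 R[i]) lerB_dist.
  move=> le1; have : 2^-1 <= `|1 - tau zeta i|.
    apply: le_trans le1; rewrite lerBrDr -lerBrDl.
    by apply: le_trans tau_half _; rewrite le_eqVlt; apply/orP; left; apply/eqP; field.
  by rewrite -ler_pdivrMl ?ltr0n // mulr1.
rewrite normrM; apply: le_trans (_ : (2 * `|d|) * (eta1 + eta1 * `|m0|) <= _).
  rewrite ler_pM //; apply: le_trans (ler_normD _ _) _.
  by rewrite lerD // normrM ler_wpM2r.
rewrite /eta1 le_eqVlt; apply/orP; left; apply/eqP; field.
by rewrite !gt_eqF.
Qed.
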